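(* Let $d\ge1$ and let $D=2d$ be the real dimension of $\mathbb{CP}^d$. There exists a constant $K>0$ such that for every integer $L\ge1$ and every metric ball $A$ in $\mathbb{CP}^d$, if $N_A$ denotes the number of points drawn from the projective ensemble with $N=\binom{d+L}{d}$ points that fall inside $A$, then $$\operatorname{Var}(N_A)\le K\,N^{1-1/D}.$$
   Context: $\mathbb{CP}^d$ carries its Riemannian (Fubini--Study) distance, normalized so that $\cos\operatorname{dist}(p,q)=\bigl|\bigl\langle \tfrac{p}{\|p\|},\tfrac{q}{\|q\|}\bigr\rangle\bigr|$ (so the diameter is $\pi/2$), and its volume measure is normalized so that $\operatorname{vol}(\mathbb{CP}^d)=1$. A simple point process $\mathcal X$ of $N$ points on $\mathbb{CP}^d$ is a random $N$-point subset. Its joint intensities $\rho_k$ satisfy $\mathbb E\bigl(\prod_{i=1}^k\#(x\cap A_i)\bigr)=\int_{\prod A_i}\rho_k(y_1,\dots,y_k)\,dy_1\cdots dy_k$ for mutually disjoint measurable $A_i$, where $x$ is sampled from $\mathcal X$. It is a determinantal point process with kernel $K$ if $\rho_k(x_1,\dots,x_k)=\det(K(x_i,x_j))_{1\le i,j\le k}$ for all $k\ge1$. Projective ensemble: for $L\ge1$ and $N=\binom{d+L}{d}$, it is the determinantal point process of $N$ points on $\mathbb{CP}^d$ whose (projection) kernel satisfies $$\bigl|K_\star^{(N,d)}(p,q)\bigr|=N\,\Bigl|\Bigl\langle\frac{p}{\|p\|},\frac{q}{\|q\|}\Bigr\rangle\Bigr|^{L},$$ where on the right $p,q\in\mathbb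 C^{d+1}$ are affine representatives of the projective points. Explicitly, $K_\star^{(N,d)}(p,q)=N\bigl\langle\frac{p}{\|p\|},\frac{q}{\|q\|}\bigr\rangle^{L}$ with representatives $p=(1,z)$, $q=(1,w)$, $z,w\in\mathbb C^d$ (defined off a hyperplane of measure zero). *)

(* Defs.v *)
From HB Require Import structures.
From mathcomp Require Import all_boot all_order all_algebra.
From mathcomp Require Import finmap.
From mathcomp Require Import all_classical all_reals all_analysis.
From mathcomp Require Import measurable_realfun spectral complex.

Set Implicit Arguments.
Unset Strict Implicit.
Unset Printing Implicit Defensive.

Import Order.TTheory GRing.Theory Num.Theory.
Import numFieldNormedType.Exports.

Local Open Scope classical_set_scope.
Local Open Scope ring_scope.

(* The library proves that [mu \x nu] is sigma-finite, but the corresponding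
   canonical instance is shadowed by the one for subprobabilities; hence this
   alias. *)
Section product_measure.
Context d1 d2 (T1 : measurableType d1) (T2 : measurableType d2) (R : realType).
Variable mu : {sigma_finite_measure set T1 -> \bar R}.
Variable nu : {sigma_finite_measure set T2 -> \bar R}.
Local Open Scope ereal_scope.

Definition product_measure : set (T1 * T2) -> \bar R := mu \x nu.

HB.instance Definition _ := Measure.on product_measure.

Let product_measure_sigma_finite : sigma_finite setT product_measure.
Proof.
have /sigma_finiteP[F [TF ndF Foo]] := sigma_finiteT mu.
have /sigma_finiteP[G [TG ndG Goo]] := sigma_finiteT nu.
exists (fun n => F n `*` G n).
  rewrite -setXTT TF TG predeqE => -[x y]; split.
    move=> [/= [n _ Fnx] [k _ Gky]]; exists (maxn n k) => //; split.
    - by move: x Fnx; exact/subsetPset/ndF/leq_maxl.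
    - by move: y Gky; exact/subsetPset/ndG/leq_maxr.
  by move=> [n _ []/= ? ?]; split; exists n.
move=> k; have [? ?] := Foo k; have [? ?] := Goo k.
split; first exact: measurableX.
by rewrite /product_measure product_measure1E// lte_mul_pinfty// ge0_fin_numE.
Qed.

HB.instance Definition _ := Measure_isSigmaFinite.Build _ _ _ product_measure
  product_measure_sigma_finite.

End product_measure.

Section measure_power_step.
Context d (T : measurableType d) (R : realType) (n : nat).
Variable mu : {sigma_finite_measure set T -> \bar R}.
Variable nu : {sigma_finite_measure set (n.-tuple T) -> \bar R}.
Local Open Scope ereal_scope.

Let consp (p : T * n.-tuple T) : n.+1.-tuple T := [tuple of p.1 :: p.2].
Let unconsp (t : n.+1.-tuple T) : T * n.-tuple T :=
  (thead t, [tuple of behead t]).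

Let measurable_consp : measurable_fun setT consp.
Proof. exact: measurable_cons. Qed.

Let measurable_unconsp : measurable_fun setT unconsp.
Proof.
by apply/measurable_fun_pair; [exact: measurable_tnth | exact: measurable_behead].
Qed.

Let conspK : cancel consp unconsp.
Proof. by case=> x t; congr pair => //; apply: val_inj. Qed.

Definition measure_power_step : set (n.+1.-tuple T) -> \bar R :=
  pushforward (product_measure mu nu) consp.

Let step0 : measure_power_step set0 = 0.
Proof. by rewrite /measure_power_step /pushforward preimage_set0 measure0. Qed.

Let step_ge0 A : 0 <= measure_power_step A.
Proof. exact: measure_ge0. Qed.

Let step_sigma_additive : semi_sigma_additive measure_power_step.
Proof.
move=> F mF tF mUF; rewrite /measure_power_step /pushforward preimage_bigcup.
apply: measure_semi_sigma_additive.
- by move=> k; rewrite -[X in measurable X]setTI; exact: measurable_consp.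
- apply/trivIsetP => /= i j _ _ ij; rewrite -preimage_setI.
  by move/trivIsetP : tF => /(_ _ _ _ _ ij) ->//; rewrite preimage_set0.
- by rewrite -preimage_bigcup -[X in measurable X]setTI; exact: measurable_consp.
Qed.

HB.instance Definition _ := isMeasure.Build _ _ _ measure_power_step
  step0 step_ge0 step_sigma_additive.

Let step_sigma_finite : sigma_finite setT measure_power_step.
Proof.
have [F FT Foo] := sigma_finiteT (product_measure mu nu).
exists (fun k => unconsp @^-1` F k).
  by rewrite -preimage_bigcup -FT preimage_setT.
move=> k; have [mF Fk] := Foo k; split.
  by rewrite -[X in measurable X]setTI; exact: measurable_unconsp.
rewrite /measure_power_step /pushforward /= -comp_preimage.
by rewrite (_ : unconsp \o consp = id)//; apply/funext => p /=; rewrite conspK.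
Qed.

HB.instance Definition _ := Measure_isSigmaFinite.Build _ _ _
  measure_power_step step_sigma_finite.

End measure_power_step.

(* [measure_power mu n] is the n-fold product of [mu], carried by the library's
   product sigma-algebra on [n.-tuple T]. *)
Fixpoint measure_power d (T : measurableType d) (R : realType)
    (mu : {sigma_finite_measure set T -> \bar R}) (n : nat) :
    {sigma_finite_measure set (n.-tuple T) -> \bar R} :=
  match n with
  | 0 => dirac ([tuple] : 0.-tuple T)
  | m.+1 => measure_power_step mu (measure_power mu m)
  end.

(* [dotmx] is linear in its first argument and conjugate-linear in the second. *)
Section unitv.
Context (C : numClosedFieldType) (n : nat).
Implicit Types (a b : C) (u v : 'rV[C]_n).

Definition unitv u : 'rV[C]_n := (sqrtC (dotmx u u))^-1 *: u.

Lemma unitvZ a u : unitv (a *: u) = (a / `|a|) *: unitv u.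
Proof.
rewrite /unitv dnormZ rootCMl ?exprn_ge0// sqrCK// !scalerA; congr (_ *: _).
by rewrite invfM mulrC mulrA.
Qed.

Lemma norm_dotmx_unitvZ a b u v : a != 0 -> b != 0 ->
  `|dotmx (unitv (a *: u)) (unitv (b *: v))| = `|dotmx (unitv u) (unitv v)|.
Proof.
move=> a0 b0; rewrite !unitvZ linearZl_LR linearZr_LR/= !normrM norm_conjC.
by rewrite normrM !normfV !normr_id !divff ?normr_eq0// !mul1r.
Qed.

Lemma dotmx_unitv u : u != 0 -> dotmx (unitv u) (unitv u) = 1.
Proof.
move=> u0; rewrite /unitv dnormZ normfV ger0_norm ?sqrtC_ge0 ?dnorm_ge0//.
by rewrite exprVn sqrtCK mulVf// dnorm_eq0.
Qed.

Lemma norm_dotmx_unitv_le1 u v : u != 0 -> v != 0 ->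
  `|dotmx (unitv u) (unitv v)| <= 1.
Proof.
move=> u0 v0; have : `|dotmx (unitv u) (unitv v)| <=
    sqrtC (dotmx (unitv u) (unitv u)) * sqrtC (dotmx (unitv v) (unitv v)).
  exact: (CauchySchwarz_sqrt _ _ _).1.
by rewrite !dotmx_unitv// sqrtC1 mulr1.
Qed.

Lemma norm_dotmx_unitvr_sqr u v :
  `|dotmx u (unitv v)| ^+ 2 = `|dotmx u v| ^+ 2 / dotmx v v.
Proof.
rewrite /unitv linearZr_LR/= normrM exprMn mulrC norm_conjC; congr (_ * _).
by rewrite normfV ger0_norm ?sqrtC_ge0 ?dnorm_ge0// exprVn sqrtCK.
Qed.

End unitv.

Definition coherence (R : realType) n (u v : 'rV[R[i]]_n) : R :=
  complex.Re `|dotmx (unitv u) (unitv v)|.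

(* The complex lines of C^(d+1). *)
Record projective_space (R : realType) (d : nat) := ProjectivePoint {
  line :> {vspace 'rV[R[i]]_d.+1};
  dim_line : \dim line == 1%N }.

HB.instance Definition _ R d := [isSub for @line R d].
HB.instance Definition _ R d := [Choice of projective_space R d by <:].

Section projective_space.
Context (R : realType).
Implicit Types d n : nat.

Definition proj d (u : 'rV[R[i]]_d.+1) (u0 : u != 0) : projective_space R d :=
  @ProjectivePoint R d <[u]>%VS (introT eqP (etrans (dim_vline u) (congr1 nat_of_bool u0))).

(* [vpick] selects a nonzero vector of the line; the choice is irrelevant, see
   [cos_fs_dist] below. *)
Definition fs_dist d (p q : projective_space R d) : R :=
  acos (coherence (vpick p) (vpick q)).

Lemma delta_row_neq0 d : delta_mx 0 0 != 0 :> 'rV[R[i]]_d.+1.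
Proof. by apply/eqP => /rowP/(_ 0); rewrite !mxE !eqxx => /eqP; rewrite oner_eq0. Qed.

HB.instance Definition _ d :=
  isPointed.Build (projective_space R d) (proj (delta_row_neq0 d)).

(* Generates the Borel sigma-algebra, the distance being separable. *)
Definition fs_balls d : set (set (projective_space R d)) :=
  [set B | exists p r, B = [set q | fs_dist p q < r]].

HB.instance Definition _ d :=
  Measurable.copy (projective_space R d) (g_sigma_algebraType (@fs_balls d)).

Let Rp := measurableTypeR R.

(* A point z of C^d is given by the d pairs (real part, imaginary part). *)
Definition affine_coord d (z : d.-tuple (Rp * Rp)) : 'rV[R[i]]_d :=
  \row_j ((tnth z j).1 +i* (tnth z j).2)%C.

Definition affine_lift d (w : 'rV[R[i]]_d) : 'rV[R[i]]_d.+1 :=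
  row_mx (1%:M : 'rV[R[i]]_1) w.

Lemma affine_lift_neq0 d (w : 'rV[R[i]]_d) : affine_lift w != 0.
Proof.
apply/eqP => /(congr1 (fun u : 'rV_(1 + d) => u 0 (lshift d 0))).
by rewrite row_mxEl !mxE eqxx => /eqP; rewrite oner_eq0.
Qed.

Definition chart d (z : d.-tuple (Rp * Rp)) : projective_space R d :=
  proj (affine_lift_neq0 (affine_coord z)).

(* Matrix of the Fubini-Study Hermitian metric at [1 : w] in the affine chart,
     h_ij = ((1 + |w|^2) delta_ij - conj(w_i) w_j) / (1 + |w|^2)^2,
   the Riemannian metric being ds^2 = sum_ij h_ij dw_i conj(dw_j); its geodesic
   distance is [fs_dist]. The underlying real 2d x 2d Gram matrix has determinant
   (det h)^2, so the Riemannian volume element is det h times the Lebesgue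
   measure of C^d = R^(2d). *)
Definition fs_metric d (w : 'rV[R[i]]_d) : 'M[R[i]]_d :=
  let s := 1 + dotmx w w in
  \matrix_(i, j) ((s *+ (i == j) - (w 0 i)^* * w 0 j) / s ^+ 2).

Definition fs_density d (z : d.-tuple (Rp * Rp)) : R :=
  complex.Re (\det (fs_metric (affine_coord z))).

Definition lebesgue_affine d : {sigma_finite_measure set (d.-tuple (Rp * Rp)) -> \bar R} :=
  measure_power (product_measure (@lebesgue_measure R) (@lebesgue_measure R)) d.

Lemma det_fs_metric d (w : 'rV[R[i]]_d) :
  \det (fs_metric w) = (1 + dotmx w w) ^- d.+1.
Proof.
set s := 1 + dotmx w w; pose v : 'cV[R[i]]_d := map_mx Num.conj w^T.
have s0 : s != 0 by rewrite gt_eqF// ltr_wpDr ?dnorm_ge0.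
have wv : w *m v = (s - 1)%:M.
  by rewrite [LHS]mx11_scalar /s addrAC subrr add0r dotmxE.
have detE : \det (s%:M - v *m w) = s ^+ d / s.
  pose B : 'M[R[i]]_(1 + d) := block_mx 1%:M w v s%:M.
  transitivity (\det B).
    have := congr1 determinant (_ : block_mx 1%:M 0 (- v) 1%:M *m B =
      block_mx 1%:M w 0 (s%:M - v *m w)).
    rewrite det_mulmx det_lblock det_ublock !det1 !mul1r => -> //.
    rewrite mulmx_block !mul0mx !addr0 !mulmx1 !mul1mx addNr.
    by rewrite mulNmx addrC.
  have E : B *m block_mx 1%:M 0 (- s^-1 *: v) 1%:M =
      block_mx s^-1%:M w 0 s%:M.
    rewrite mulmx_block !mulmx0 !mulmx1 !add0r -!scalemxAr wv mul_scalar_mx.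
    rewrite scalerA mulNr mulVf// scaleN1r subrr scale_scalar_mx.
    by rewrite -raddfD/= mulrBr mulr1 mulNr mulVf// opprK addrA subrr add0r.
  have /(congr1 determinant) := E.
  rewrite det_mulmx det_lblock !det1 !mulr1 => ->.
  by rewrite det_ublock !det_scalar expr1 mulrC.
have -> : fs_metric w = s ^- 2 *: (s%:M - v *m w).
  apply/matrixP => i j; rewrite !mxE big_ord1 !mxE.
  by rewrite [LHS]mulrC.
rewrite detZ detE -exprVn -exprM mul2n -addnn exprD -mulrA [_ * (_ / _)]mulrA.
by rewrite -exprMn mulVf// expr1n mul1r -exprSr exprVn.
Qed.

End projective_space.

Section fs_volume.
Context (R : realType) (d : nat).
Local Notation C2 := (measurableTypeR R * measurableTypeR R)%type.
Implicit Types (z : d.-tuple C2).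

Definition sqnorm_affine z : R := \sum_j ((tnth z j).1 ^+ 2 + (tnth z j).2 ^+ 2).

Lemma dotmx_affine_coord z :
  dotmx (affine_coord z) (affine_coord z) = (sqnorm_affine z)%:C%C.
Proof.
rewrite dotmxE mxE /sqnorm_affine rmorph_sum/=; apply: eq_bigr => j _.
by rewrite !mxE -normCK -add_Re2_Im2.
Qed.

Lemma sqnorm_affine_ge0 z : 0 <= sqnorm_affine z.
Proof. by apply: sumr_ge0 => j _; rewrite addr_ge0 ?sqr_ge0. Qed.

Lemma fs_densityE z : fs_density z = (1 + sqnorm_affine z) ^- d.+1.
Proof.
rewrite /fs_density det_fs_metric dotmx_affine_coord -(rmorph1 (real_complex R)).
by rewrite -rmorphD -rmorphXn -fmorphV.
Qed.

Lemma fs_density_ge0 z : 0 <= fs_density z.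
Proof. by rewrite fs_densityE invr_ge0 exprn_ge0// addr_ge0 ?sqnorm_affine_ge0. Qed.

Lemma measurable_fst_tnth j : measurable_fun setT (fun z => (tnth z j).1 : R).
Proof. by apply: (measurableT_comp measurable_fst); exact: measurable_tnth. Qed.

Lemma measurable_snd_tnth j : measurable_fun setT (fun z => (tnth z j).2 : R).
Proof. by apply: (measurableT_comp measurable_snd); exact: measurable_tnth. Qed.

Lemma measurable_sqnorm_affine : measurable_fun setT sqnorm_affine.
Proof.
apply: measurable_sum => j; apply: measurable_funD; apply: measurable_funX.
  exact: measurable_fst_tnth.
exact: measurable_snd_tnth.
Qed.

Lemma measurable_inv_ge0 (f : d.-tuple C2 -> R) : (forall z, 0 <= f z) ->
  measurable_fun setT f -> measurable_fun setT (fun z => (f z)^-1).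
Proof.
move=> f0 mf.
rewrite (_ : (fun z => _) = (fun z => f z `^ (-1))).
  exact: (measurableT_comp (@measurable_powR R (-1)) mf).
by apply/funext => z; rewrite powR_inv1.
Qed.

Lemma measurable_fs_density : measurable_fun setT (@fs_density R d).
Proof.
rewrite (_ : @fs_density R d = fun z => (1 + sqnorm_affine z) ^- d.+1); last first.
  by apply/funext => z; rewrite fs_densityE.
apply: measurable_inv_ge0.
  by move=> z; rewrite exprn_ge0// addr_ge0 ?sqnorm_affine_ge0.
apply: measurable_funX; apply: measurable_funD => //.
exact: measurable_sqnorm_affine.
Qed.

Lemma vpick_proj (u : 'rV[R[i]]_d.+1) (u0 : u != 0) :
  exists2 a : R[i], a != 0 & vpick (proj u0) = a *: u :> 'rV[R[i]]_d.+1.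
Proof.
have /vlineP[a aE] := memv_pick (proj u0); exists a => //.
apply/eqP => a0; have /eqP : vpick (proj u0) = 0 by rewrite aE a0 scale0r.
rewrite vpick0 => /eqP p0; have : u \in line (proj u0) by exact: memv_line.
by rewrite p0 memv0 (negPf u0).
Qed.

Lemma coherenceZ n (a b : R[i]) (u v : 'rV[R[i]]_n) : a != 0 -> b != 0 ->
  coherence (a *: u) (b *: v) = coherence u v.
Proof. by move=> a0 b0; rewrite /coherence (norm_dotmx_unitvZ u v a0 b0). Qed.

Lemma coherence_itv n (u v : 'rV[R[i]]_n) : u != 0 -> v != 0 ->
  0 <= coherence u v <= 1.
Proof.
move=> u0 v0; apply/andP; split.
  by have := normr_ge0 (dotmx (unitv u) (unitv v)); rewrite lecE/= => /andP[].
by have := norm_dotmx_unitv_le1 u0 v0; rewrite lecE/= => /andP[].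
Qed.

Lemma fs_distE (u v : 'rV[R[i]]_d.+1) (u0 : u != 0) (v0 : v != 0) :
  fs_dist (proj u0) (proj v0) = acos (coherence u v).
Proof.
have [a a0 aE] := vpick_proj u0; have [b b0 bE] := vpick_proj v0.
by rewrite /fs_dist aE bE coherenceZ.
Qed.

Lemma cos_fs_dist (u v : 'rV[R[i]]_d.+1) (u0 : u != 0) (v0 : v != 0) :
  cos (fs_dist (proj u0) (proj v0)) = coherence u v.
Proof.
rewrite fs_distE acosK// in_itv/=; have /andP[c0 ->] := coherence_itv u0 v0.
by rewrite andbT (le_trans _ c0)// oppr_le0.
Qed.

Lemma vpick_neq0 (p : projective_space R d) : vpick p != 0.
Proof.
rewrite vpick0; apply/eqP => p0; have := dim_line p.
by rewrite p0 dimv0.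
Qed.

Lemma proj_vpick (p : projective_space R d) : proj (vpick_neq0 p) = p.
Proof.
apply: val_inj => /=; apply/eqP; rewrite eqEdim dim_vline vpick_neq0.
by rewrite (eqP (dim_line p)) leqnn andbT -memvE memv_pick.
Qed.

Lemma dotmx_affine_lift (u : 'rV[R[i]]_(1 + d)) (w : 'rV[R[i]]_d) :
  dotmx u (affine_lift w) =
  u 0 (lshift d 0) + \sum_j u 0 (rshift 1 j) * (w 0 j)^*.
Proof.
rewrite dotmxE mxE big_split_ord big_ord1 !mxE (unsplitK (inl _)) !mxE eqxx.
rewrite conjC1 mulr1; congr (_ + _); apply: eq_bigr => j _.
by rewrite !mxE (unsplitK (inr _)).
Qed.

Lemma dotmx_affine_lift2 z :
  dotmx (affine_lift (affine_coord z)) (affine_lift (affine_coord z)) =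
  (1 + sqnorm_affine z)%:C%C.
Proof.
have -> : (1 + sqnorm_affine z)%:C%C = 1 + (sqnorm_affine z)%:C%C :> R[i].
  by rewrite rmorphD rmorph1.
rewrite dotmx_affine_lift -dotmx_affine_coord dotmxE [in RHS]mxE.
congr (_ + _); first by rewrite row_mxEl !mxE.
by apply: eq_bigr => j _; rewrite row_mxEr !mxE.
Qed.

Lemma measurable_re_im_dotmx (u : 'rV[R[i]]_d.+1) :
  measurable_fun setT
    (fun z => complex.Re (dotmx u (affine_lift (affine_coord z)))) /\
  measurable_fun setT
    (fun z => complex.Im (dotmx u (affine_lift (affine_coord z)))).
Proof.
have ReD : {morph @complex.Re R : x y / x + y} by move=> [? ?] [? ?].
have ImD : {morph @complex.Im R : x y / x + y} by move=> [? ?] [? ?].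
pose v j := (u : 'rV_(1 + d)) 0 (rshift 1 j).
split.
- rewrite (_ : (fun z => _) = fun z =>
      complex.Re ((u : 'rV_(1 + d)) 0 (lshift d 0)) +
      \sum_j (complex.Re (v j) * (tnth z j).1 + complex.Im (v j) * (tnth z j).2)).
    apply: measurable_funD => //; apply: measurable_sum => j.
    apply: measurable_funD; apply: measurable_funM => //.
      exact: measurable_fst_tnth.
    exact: measurable_snd_tnth.
  apply/funext => z; rewrite dotmx_affine_lift ReD (big_morph _ ReD (erefl _)).
  congr (_ + _); apply: eq_bigr => j _; rewrite /v mxE.
  by case: (u _ _) => a b /=; rewrite mulrN opprK.
- rewrite (_ : (fun z => _) = fun z =>
      complex.Im ((u : 'rV_(1 + d)) 0 (lshift d 0)) +
      \sum_j (complex.Im (v j) * (tnth z j).1 - complex.Re (v j) * (tnth z j).2)).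
    apply: measurable_funD => //; apply: measurable_sum => j.
    apply: measurable_funB; apply: measurable_funM => //.
      exact: measurable_fst_tnth.
    exact: measurable_snd_tnth.
  apply/funext => z; rewrite dotmx_affine_lift ImD (big_morph _ ImD (erefl _)).
  congr (_ + _); apply: eq_bigr => j _; rewrite /v mxE.
  by case: (u _ _) => a b /=; rewrite mulrN addrC.
Qed.

Lemma measurable_coherence_chart (u : 'rV[R[i]]_d.+1) :
  measurable_fun setT (fun z =>
    coherence u (affine_lift (affine_coord z))).
Proof.
have [mre mim] := measurable_re_im_dotmx (unitv u).
rewrite (_ : (fun z => _) = fun z => Num.sqrt (
    (complex.Re (dotmx (unitv u) (affine_lift (affine_coord z))) ^+ 2 +
     complex.Im (dotmx (unitv u) (affine_lift (affine_coord z))) ^+ 2) *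
    (1 + sqnorm_affine z)^-1)).
  apply: (measurableT_comp (continuous_measurable_fun (@sqrt_continuous R))).
  apply: measurable_funM.
    by apply: measurable_funD; apply: measurable_funX.
  apply: measurable_inv_ge0.
    by move=> z; rewrite addr_ge0 ?sqnorm_affine_ge0.
  by apply: measurable_funD => //; exact: measurable_sqnorm_affine.
apply/funext => z; rewrite /coherence; set l := affine_lift _.
set D := dotmx _ (unitv l).
have D0 : 0 <= complex.Re `|D| by have := normr_ge0 D; rewrite lecE/= => /andP[].
have DE : (complex.Re `|D|)%:C%C = `|D| by rewrite RRe_real ?normr_real.
rewrite -[LHS]ger0_norm// -sqrtr_sqr; congr Num.sqrt; apply: complexI.
rewrite rmorphXn/= DE rmorphM/= add_Re2_Im2 fmorphV/= -dotmx_affine_lift2 -/l.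
exact: norm_dotmx_unitvr_sqr.
Qed.

Lemma measurable_chart : measurable_fun setT (@chart R d).
Proof.
apply: (measurability (@fs_balls R d)) => // _ [_ [p [r ->]] <-]; rewrite setTI.
rewrite -(proj_vpick p); set u := vpick p in (u0 := vpick_neq0 p) *.
pose c z := coherence u (affine_lift (affine_coord z)).
have cE z : (@fs_dist R d (proj u0) (chart z) < r) = (acos (c z) < r).
  by rewrite fs_distE.
have c_itv z : 0 <= c z <= 1 by exact: coherence_itv u0 (affine_lift_neq0 _).
have c11 z : -1 <= c z <= 1.
  have /andP[c0 ->] := c_itv z; by rewrite andbT (le_trans _ c0)// oppr_le0.
have [r0|r0] := leP r 0.
  rewrite (_ : _ @^-1` _ = set0)//; apply/seteqP; split => // z /=.
  by rewrite cE ltNge (le_trans r0)// acos_ge0.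
have [rpi|rpi] := ltP pi r.
  rewrite (_ : _ @^-1` _ = setT)//; apply/seteqP; split => // z _ /=.
  by rewrite cE (le_lt_trans _ rpi)// acos_lepi.
rewrite (_ : _ @^-1` _ = setT `&` c @^-1` `]cos r, +oo[%classic).
  by apply: (measurable_coherence_chart u) => //; exact: measurable_itv.
have acosE z : (acos (c z) < r) = (cos r < c z).
  rewrite -[in RHS](@acosK _ (c z)) ?in_itv/= ?c11// ltr_cos// in_itv/=.
    by rewrite acos_ge0 ?acos_lepi.
  by rewrite (ltW r0).
by rewrite setTI; apply/seteqP; split => z /=; rewrite cE in_itv/= andbT acosE.
Qed.

(* The hyperplane at infinity, which the chart misses, is a null set. *)
Definition riemannian_volume (A : set (projective_space R d)) : \bar R :=
  (\int[lebesgue_affine R d]_(z in @chart R d @^-1` A) (fs_density z)%:E)%E.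

Let riemannian_volume0 : riemannian_volume set0 = 0%E.
Proof. by rewrite /riemannian_volume preimage_set0 integral_set0. Qed.

Let riemannian_volume_ge0 A : (0 <= riemannian_volume A)%E.
Proof. by apply: integral_ge0 => z _; rewrite lee_fin fs_density_ge0. Qed.

Let riemannian_volume_sigma_additive : semi_sigma_additive riemannian_volume.
Proof.
move=> F mF tF mUF; rewrite /riemannian_volume preimage_bigcup.
apply: semi_sigma_additive_nng_induced.
- by apply/measurable_EFinP; exact: measurable_fs_density.
- by move=> z; rewrite lee_fin fs_density_ge0.
- by move=> k; rewrite -[X in measurable X]setTI; exact: measurable_chart.
- apply/trivIsetP => /= i j _ _ ij; rewrite -preimage_setI.
  by move/trivIsetP : tF => /(_ _ _ _ _ ij) ->//; rewrite preimage_set0.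
- by rewrite -preimage_bigcup -[X in measurable X]setTI; exact: measurable_chart.
Qed.

HB.instance Definition _ := isMeasure.Build _ _ _ riemannian_volume
  riemannian_volume0 riemannian_volume_ge0 riemannian_volume_sigma_additive.

(* [riemannian_volume] has total mass pi^d / d!, so that the default measure
   required by [mnormalize] for masses 0 and +oo plays no role. *)
Definition fs_volume : probability (projective_space R d) R :=
  mnormalize riemannian_volume (dirac point).

End fs_volume.

Section point_process.
Context dO (Omega : measurableType dO) (R : realType) (P : probability Omega R).
Context dT (T : measurableType dT).
Implicit Types (X : Omega -> {fset T}) (A : set T).

Definition num_points X A (w : Omega) : nat :=
  #|` [fset x in X w | x \in A]%fset|.

Definition simple_point_process (N : nat) X :=
  (forall w, #|` X w| = N) /\
  forall A, measurable A -> measurable_fun setT (num_points X A).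

Definition joint_intensity (mu : {sigma_finite_measure set T -> \bar R}) X
    (k : nat) (rho : k.-tuple T -> R) :=
  measurable_fun setT rho /\
  forall A : 'I_k -> set T, (forall i, measurable (A i)) ->
    trivIset setT A ->
    ('E_P[fun w => (\prod_(i < k) (num_points X (A i) w)%:R)%R] =
     \int[measure_power mu k]_(y in [set y | forall i, A i (tnth y i)])
       (rho y)%:E)%E.

Definition determinantal (mu : {sigma_finite_measure set T -> \bar R}) X
    (K : T -> T -> R[i]) :=
  forall k, (0 < k)%N -> exists rho : k.-tuple T -> R,
    joint_intensity mu X rho /\
    forall y, (rho y)%:C%C = \det (\matrix_(i, j) K (tnth y i) (tnth y j)).

End point_process.

Section projective_ensemble.
Context (R : realType) (d : nat).
Implicit Types p q : projective_space R d.

(* The representative of the form (1, z) whenever there is one; on the null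
   hyperplane at infinity, an arbitrary representative. The determinants of
   [projective_kernel] do not depend on the choice of representatives, since
   changing them multiplies the kernel by unit factors c(p) conj(c(q)). *)
Definition affine_rep p : 'rV[R[i]]_d.+1 :=
  let v := vpick p in if v 0 0 == 0 then v else (v 0 0)^-1 *: v.

Definition projective_kernel (L : nat) p q : R[i] :=
  'C(d + L, d)%:R * dotmx (unitv (affine_rep p)) (unitv (affine_rep q)) ^+ L.

Definition projective_ensemble dO (Omega : measurableType dO)
    (P : probability Omega R) (L : nat)
    (X : Omega -> {fset projective_space R d}) :=
  simple_point_process 'C(d + L, d) X /\
  determinantal P (fs_volume R d) X (projective_kernel L).

(* Open or closed. *)
Definition metric_ball (A : set (projective_space R d)) :=
  exists p r, 0 < r /\
    (A = [set q | fs_dist p q < r] \/ A = [set q | fs_dist p q <= r]).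

End projective_ensemble.

(* Main.v *)
(* The total number of points is the constant N, so Var(N_A) is minus the covariance of N_A and
   N_{A^c}. The joint intensities of orders 1 and 2 thus give Var(N_A) = N^2 times the integral
   over A x A^c of t(p,q)^L, where t(p,q) = |<p,q>|^2 for unit representatives is the overlap.

   For fixed p, the overlap with a uniform q has law Beta(1,d). To see this, integrate a function
   of |<p,u>|^2 / |u|^2 over the unit ball of C^(d+1). Writing u = x (1,w) gives a constant times
   the integral in the affine chart; rotating p to the first basis vector and using that |u_0|^2
   and |u_1|^2 + ... + |u_d|^2 have densities proportional to r^0 and r^(d-1) gives the beta
   integral.

   A ball is {t(p0,.) >= a} up to boundary points, and |t(p0,p) - t(p0,q)| <= 2 sqrt(1 - t(p,q)).
   Hence p in A and q not in A force a <= t(p0,p) <= a + 2 sqrt(1 - t(p,q)), an event of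
   probability at most 2 d sqrt(1 - t) given t = t(p,q). With
   2 sqrt(1 - t) <= L^(-1/2) + L^(1/2) (1 - t), the moments of the beta law bound the variance by
   d (d+1) N / sqrt L, and N <= (2 L)^d. *)
Require Import Defs.
From mathcomp Require Import all_boot all_order all_algebra.
From mathcomp Require Import finmap.
From mathcomp Require Import all_classical all_reals all_analysis.
From mathcomp Require Import measurable_realfun spectral complex.
From mathcomp Require Import ring lra.

Set Implicit Arguments.
Unset Strict Implicit.
Unset Printing Implicit Defensive.

Import Order.TTheory GRing.Theory Num.Theory.
Import numFieldNormedType.Exports.

Local Open Scope classical_set_scope.
Local Open Scope ring_scope.

(** * Linear changes of variables in Lebesgue integrals *)

(** The volume is defined through a single affine chart, where its unitary invariance is not
    visible: a unitary map acts on the chart by homographies and moves the hyperplane at infinity.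
    On C^(d+1) the action is linear, which is why the ball is used. There, every linear change of
    variables is derived from x -> a x + b on the real line and Tonelli: these give scaled shears of
    the plane, two shears give a complex multiplication, and a unitary substitution in two
    coordinates, iterated, carries any linear form to a multiple of a coordinate.

    The square root in the width of the shell would call for a beta moment of half-integer order.
    The quadratic inequality trades it for the orders 0 and 1 in 1 - t, where the beta function is a
    ratio of factorials. Its weights L^(-1/2) and L^(1/2) balance the two terms, because 1 - t has
    mean of order 1/L under the beta law weighted by t^L. The exponent in the theorem then reflects
    that L has order N^(1/d), so that N / sqrt L has order N^(1 - 1/(2d)). *)

Section lebesgue_line.
Context (R : realType).
Local Notation Rp := (measurableTypeR R).
Local Notation mu := (@lebesgue_measure R).
Local Open Scope ereal_scope.

Lemma measurable_affine (a b : R) :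
  measurable_fun setT (fun x : Rp => (a * x + b)%R : Rp).
Proof. by apply: measurable_funD => //; apply: measurable_funM. Qed.

Lemma preimage_affine_itv (a b p q : R) : (0 < a)%R ->
  (fun x : R => a * x + b)%R @^-1` `]p, q]%classic%R =
  `](p - b) / a, (q - b) / a]%classic%R.
Proof.
move=> a0; apply/seteqP; split => x /=; rewrite !in_itv/=.
  by rewrite ltr_pdivrMr// ler_pdivlMr// ltrBlDr lerBrDr mulrC.
by rewrite ltr_pdivrMr// ler_pdivlMr// ltrBlDr lerBrDr mulrC.
Qed.

(** The image of Lebesgue measure, rescaled by a, gives half-open intervals their length, and this
    characterizes Lebesgue measure. *)
Lemma lebesgue_measure_affine (a b : R) (A : set Rp) : (0 < a)%R -> measurable A ->
  mu A = a%:E * mu ((fun x : Rp => (a * x + b)%R : Rp) @^-1` A).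
Proof.
move=> a0 mA.
pose m : {measure set Rp -> \bar R} :=
  mscale (NngNum (ltW a0)) (pushforward mu (fun x : Rp => (a * x + b)%R : Rp)).
rewrite (@lebesgue_measure_unique _ (m (measurable_affine a b)))//= => _ [[p q]] _ <- /=.
rewrite /mscale /= /pushforward preimage_affine_itv//.
rewrite !lebesgue_measure_itv/= !lte_fin ltr_pM2r ?invr_gt0// ltrD2r.
case: ifP => // _; last by rewrite mule0.
by rewrite -!EFinD -EFinM; congr EFin; field; rewrite gt_eqF.
Qed.

Lemma ge0_integral_affine_gt0 (a b : R) (f : Rp -> \bar R) : (0 < a)%R ->
  measurable_fun setT f -> (forall x, 0 <= f x) ->
  \int[mu]_x f x = a%:E * \int[mu]_x f (a * x + b)%R.
Proof.
move=> a0 mf f0.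
pose m : {measure set Rp -> \bar R} :=
  mscale (NngNum (ltW a0))
    (pushforward mu (fun x : Rp => (a * x + b)%R : Rp)).
rewrite (eq_measure_integral (m (measurable_affine a b)))//=; last first.
  by move=> A mA _; exact: lebesgue_measure_affine.
rewrite ge0_integral_mscale//= ge0_integral_pushforward//.
exact: measurable_affine.
Qed.

Lemma ge0_integral_opp (f : Rp -> \bar R) :
  measurable_fun setT f -> (forall x, 0 <= f x) ->
  \int[mu]_x f x = \int[mu]_x f (- x)%R.
Proof.
move=> mf f0.
have mN : measurable_fun setT (fun x : Rp => (- x)%R : Rp) by exact: oppr_measurable.
pose m : {measure set Rp -> \bar R} := pushforward mu (fun x : Rp => (- x)%R : Rp).
rewrite (eq_measure_integral (m mN)) ?ge0_integral_pushforward// => A mA _.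
exact/esym/lebesgue_measureN.
Qed.

Lemma ge0_integral_affine (a b : R) (f : Rp -> \bar R) : (a != 0)%R ->
  measurable_fun setT f -> (forall x, 0 <= f x) ->
  \int[mu]_x f x = `|a|%:E * \int[mu]_x f (a * x + b)%R.
Proof.
move=> a0 mf f0; have [a1|a1|a1] := ltgtP 0%R a; last by rewrite -a1 eqxx in a0.
  by rewrite gtr0_norm//; exact: ge0_integral_affine_gt0.
rewrite ltr0_norm// (@ge0_integral_affine_gt0 (- a) b)// ?oppr_gt0//.
rewrite [X in _ * X]ge0_integral_opp//.
  by under eq_integral do rewrite mulrNN.
by apply: measurableT_comp => //; exact: measurable_affine.
Qed.

Lemma ge0_integral_shift (b : R) (f : Rp -> \bar R) :
  measurable_fun setT f -> (forall x, 0 <= f x) ->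
  \int[mu]_x f (x + b)%R = \int[mu]_x f x.
Proof.
move=> mf f0; rewrite [RHS](@ge0_integral_affine 1 b)// normr1 mul1e.
by under [RHS]eq_integral do rewrite mul1r.
Qed.

End lebesgue_line.

(** * Iterated integrals over products and tuples *)

Section product_integrals.
Local Open Scope ereal_scope.
Context d1 d2 (T1 : measurableType d1) (T2 : measurableType d2) (R : realType).
Variable m1 : {sigma_finite_measure set T1 -> \bar R}.
Variable m2 : {sigma_finite_measure set T2 -> \bar R}.

Lemma ge0_integral_product_measure (f : T1 * T2 -> \bar R) :
  measurable_fun setT f -> (forall x, 0 <= f x) ->
  \int[product_measure m1 m2]_z f z = \int[m1]_x \int[m2]_y f (x, y).
Proof. by move=> mf f0; rewrite -fubini_tonelli1. Qed.

End product_integrals.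

Lemma ge0_integral_measure_power_step d1 (T1 : measurableType d1) (R : realType)
    (m1 : {sigma_finite_measure set T1 -> \bar R}) n
    (nu : {sigma_finite_measure set (n.-tuple T1) -> \bar R})
    (f : n.+1.-tuple T1 -> \bar R) :
  measurable_fun setT f -> (forall x, 0 <= f x)%E ->
  (\int[measure_power_step m1 nu]_z f z =
  \int[m1]_x \int[nu]_y f [tuple of x :: y])%E.
Proof.
move=> mf f0; rewrite ge0_integral_pushforward//; last exact: measurable_cons.
rewrite preimage_setT ge0_integral_product_measure//; last by move=> x /=.
by apply: measurableT_comp => //; exact: measurable_cons.
Qed.

(** * Shears and complex multiplications of the plane *)

Section lebesgue_plane.
Context (R : realType).
Local Notation Rp := (measurableTypeR R).
Local Notation C2 := (Rp * Rp)%type.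
Local Notation mu := (@lebesgue_measure R).
Definition lebesgue_plane : {sigma_finite_measure set C2 -> \bar R} :=
  product_measure mu mu.

(** Complex multiplication on pairs of reals, since these carry the Lebesgue measure of the chart;
    [sqn] is the squared modulus. *)
Definition cmul (a z : C2) : C2 :=
  ((a.1 * z.1 - a.2 * z.2)%R, (a.1 * z.2 + a.2 * z.1)%R).

Definition sqn (z : C2) : R := z.1 ^+ 2 + z.2 ^+ 2.

Lemma sqn_ge0 z : 0 <= sqn z.
Proof. by rewrite addr_ge0// sqr_ge0. Qed.

Lemma sqn_eq0 z : (sqn z == 0) = (z == (0, 0)).
Proof. by case: z => x y; rewrite /sqn paddr_eq0 ?sqr_ge0// !sqrf_eq0. Qed.

Lemma sqn_cmul a z : sqn (cmul a z) = sqn a * sqn z.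
Proof. by rewrite /sqn/=; ring. Qed.

Lemma measurable_sqn : measurable_fun setT sqn.
Proof.
by apply: measurable_funD; apply: measurable_funX.
Qed.

Lemma measurable_cmul d (T : measurableType d) (f g : T -> C2) :
  measurable_fun setT f -> measurable_fun setT g ->
  measurable_fun setT (fun x => cmul (f x) (g x)).
Proof.
move=> mf mg.
have mf1 := measurableT_comp measurable_fst mf.
have mf2 := measurableT_comp measurable_snd mf.
have mg1 := measurableT_comp measurable_fst mg.
have mg2 := measurableT_comp measurable_snd mg.
apply/measurable_fun_pair.
  by apply: measurable_funB; apply: measurable_funM.
by apply: measurable_funD; apply: measurable_funM.
Qed.

Local Open Scope ereal_scope.

Lemma ge0_integral_plane1 (f : C2 -> \bar R) :
  measurable_fun setT f -> (forall z, 0 <= f z) ->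
  \int[lebesgue_plane]_z f z = \int[mu]_x \int[mu]_y f (x, y).
Proof. exact: ge0_integral_product_measure. Qed.

Lemma ge0_integral_plane2 (f : C2 -> \bar R) :
  measurable_fun setT f -> (forall z, 0 <= f z) ->
  \int[lebesgue_plane]_z f z = \int[mu]_y \int[mu]_x f (x, y).
Proof. by move=> mf f0; rewrite -(fubini_tonelli2 f). Qed.

(** A scaled shear: at fixed first coordinate it is an affine map of the line, so Tonelli reduces it
    to the one-dimensional substitution. *)
Lemma ge0_integral_plane_map2 (a : R) (g : R -> R) (f : C2 -> \bar R) :
  (a != 0)%R -> measurable_fun setT g ->
  measurable_fun setT f -> (forall z, 0 <= f z) ->
  \int[lebesgue_plane]_z f z =
    `|a|%:E * \int[lebesgue_plane]_z f (z.1, a * z.2 + g z.1)%R.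
Proof.
move=> a0 mg mf f0.
have mf2 : measurable_fun setT (fun z : C2 => f (z.1, a * z.2 + g z.1)%R).
  apply: (measurableT_comp mf); apply/measurable_fun_pair => //.
  apply: measurable_funD; first exact: measurable_funM.
  exact: (measurableT_comp mg).
rewrite !ge0_integral_plane1//= -ge0_integralZl//; last 2 first.
- exact: (measurable_fun_fubini_tonelli_F (fun z : C2 => f (z.1, a * z.2 + g z.1)%R)).
- by move=> x _; apply: integral_ge0.
apply: eq_integral => x _; rewrite (@ge0_integral_affine _ a (g x))//.
exact: (measurableT_comp mf).
Qed.

Lemma ge0_integral_plane_map1 (a : R) (g : R -> R) (f : C2 -> \bar R) :
  (a != 0)%R -> measurable_fun setT g ->
  measurable_fun setT f -> (forall z, 0 <= f z) ->
  \int[lebesgue_plane]_z f z =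
    `|a|%:E * \int[lebesgue_plane]_z f (a * z.1 + g z.2, z.2)%R.
Proof.
move=> a0 mg mf f0.
have mf2 : measurable_fun setT (fun z : C2 => f (a * z.1 + g z.2, z.2)%R).
  apply: (measurableT_comp mf); apply/measurable_fun_pair => //.
  apply: measurable_funD; first exact: measurable_funM.
  exact: (measurableT_comp mg).
rewrite !ge0_integral_plane2//= -ge0_integralZl//; last 2 first.
- exact: (measurable_fun_fubini_tonelli_G (fun z : C2 => f (a * z.1 + g z.2, z.2)%R)).
- by move=> x _; apply: integral_ge0.
apply: eq_integral => x _; rewrite (@ge0_integral_affine _ a (g x))//.
exact: (measurableT_comp mf).
Qed.

Lemma ge0_integral_plane_swap (f : C2 -> \bar R) :
  measurable_fun setT f -> (forall z, 0 <= f z) ->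
  \int[lebesgue_plane]_z f z = \int[lebesgue_plane]_z f (z.2, z.1).
Proof.
move=> mf f0; rewrite ge0_integral_plane1// ge0_integral_plane2//=.
by apply: (measurableT_comp mf); exact/measurable_fun_pair.
Qed.

Lemma ge0_integral_plane_affine (r : R) (c : C2) (f : C2 -> \bar R) :
  (r != 0)%R -> measurable_fun setT f -> (forall z, 0 <= f z) ->
  \int[lebesgue_plane]_z f z =
    (r ^+ 2)%:E * \int[lebesgue_plane]_z f (r * z.1 + c.1, r * z.2 + c.2)%R.
Proof.
move=> r0 mf f0.
rewrite (@ge0_integral_plane_map2 r (cst c.2))//.
rewrite (@ge0_integral_plane_map1 r (cst c.1) (fun z => f (z.1, r * z.2 + c.2)%R))//=.
  by rewrite muleA -EFinM -normrM ger0_norm -?expr2// sqr_ge0.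
apply: (measurableT_comp mf); apply/measurable_fun_pair => //=.
by apply: measurable_funD => //; exact: measurable_funM.
Qed.

(** When the real part of [a] is nonzero, the matrix of multiplication by [a] is a product of two
    triangular matrices with scaling factors [sqn a / a.1] and [a.1], whose product is the Jacobian.
    When it vanishes, the map is a swap of the coordinates with two scalings. *)
Lemma ge0_integral_plane_cmul (a : C2) (f : C2 -> \bar R) :
  sqn a != 0%R -> measurable_fun setT f -> (forall z, 0 <= f z) ->
  \int[lebesgue_plane]_z f z =
    (sqn a)%:E * \int[lebesgue_plane]_z f (cmul a z).
Proof.
case: a => a b a0 mf f0; have [a_eq0|a1] := eqVneq a 0%R.
  have b0 : b != 0%R.
    by move: a0; apply: contra => /eqP ->; rewrite a_eq0 /sqn /= expr0n/= addr0.
  rewrite ge0_integral_plane_swap// (@ge0_integral_plane_map2 (- b) (cst 0%R))//.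
  - rewrite (@ge0_integral_plane_map1 b (cst 0%R))//=.
    + rewrite muleA -EFinM normrN -normrM ger0_norm ?sqr_ge0// /sqn /=.
      rewrite a_eq0 expr0n/= add0r expr2; congr (_ * _).
      apply: eq_integral => z _; congr f.
      by rewrite /cmul/= !mul0r !addr0 sub0r add0r mulNr.
    + apply: (measurableT_comp mf); apply/measurable_fun_pair => //=.
      by apply: measurable_funD => //; exact: measurable_funM.
  - by rewrite oppr_eq0.
  - by apply: (measurableT_comp mf); apply/measurable_fun_pair.
rewrite (@ge0_integral_plane_map2 (sqn (a, b) / a)%R (fun x => b / a * x)%R)//;
  last 2 first.
- by rewrite mulf_neq0// invr_eq0.
- exact: measurable_funM.
rewrite (@ge0_integral_plane_map1 a (fun y => - b * y)%R)//=; last 2 first.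
- exact: measurable_funM.
- apply: (measurableT_comp mf); apply/measurable_fun_pair => //=.
  by apply: measurable_funD; exact: measurable_funM.
rewrite muleA -EFinM -normrM mulfVK// ger0_norm ?sqn_ge0//; congr (_ * _).
apply: eq_integral => z _; congr f; rewrite /cmul /sqn/=.
by congr pair; field.
Qed.

End lebesgue_plane.

(** * Rotation invariance in C^n *)

Section rotation.
Context (R : realType).
Local Notation Rp := (measurableTypeR R).
Local Notation C2 := (Rp * Rp)%type.
Local Notation mu := (@lebesgue_measure R).
Local Notation lam := (lebesgue_plane R).
Local Open Scope ereal_scope.

Definition cadd (z w : C2) : C2 := (z.1 + w.1, z.2 + w.2)%R.
Definition cscale (r : R) (z : C2) : C2 := (r * z.1, r * z.2)%R.
Definition cconj (z : C2) : C2 := (z.1, - z.2)%R.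

Lemma measurable_cadd d (T : measurableType d) (f g : T -> C2) :
  measurable_fun setT f -> measurable_fun setT g ->
  measurable_fun setT (fun x => cadd (f x) (g x)).
Proof.
move=> mf mg.
have mf1 := measurableT_comp measurable_fst mf.
have mf2 := measurableT_comp measurable_snd mf.
have mg1 := measurableT_comp measurable_fst mg.
have mg2 := measurableT_comp measurable_snd mg.
by apply/measurable_fun_pair; apply: measurable_funD.
Qed.

Lemma measurable_cscale d (T : measurableType d) (f : T -> C2) (r : T -> R) :
  measurable_fun setT r -> measurable_fun setT f ->
  measurable_fun setT (fun x => cscale (r x) (f x)).
Proof.
move=> mr mf.
have mf1 := measurableT_comp measurable_fst mf.
have mf2 := measurableT_comp measurable_snd mf.
by apply/measurable_fun_pair; apply: measurable_funM.
Qed.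

Lemma measurable_sqn_comp d (T : measurableType d) (f : T -> C2) :
  measurable_fun setT f -> measurable_fun setT (fun x => sqn (f x)).
Proof. by move=> mf; apply: measurableT_comp (@measurable_sqn R) mf. Qed.

(** Multiplying u by the unit number conj(a) / |a| turns a u into |a| u, preserves |u| and has
    Jacobian 1. *)
Lemma rotation_phase (a : C2) (F : C2 * R -> \bar R) :
  measurable_fun setT F -> (forall p, 0 <= F p) ->
  \int[lam]_u F (cmul a u, sqn u) =
  \int[lam]_u F (cscale (Num.sqrt (sqn a)) u, sqn u).
Proof.
move=> mF F0; have [a0|a0] := eqVneq (sqn a) 0%R.
  rewrite a0 sqrtr0; move/eqP: a0; rewrite sqn_eq0 => /eqP ->.
  by apply: eq_integral => u _; rewrite /cmul /cscale/= !mul0r subrr addr0.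
set r := Num.sqrt (sqn a).
have r2 : (r ^+ 2 = sqn a)%R by rewrite sqr_sqrtr ?sqn_ge0.
have r0 : r != 0%R by apply: contra a0 => /eqP r0; rewrite -r2 r0 expr0n.
have sa : sqn (cscale r^-1 (cconj a)) = 1%R.
  have -> : sqn (cscale r^-1 (cconj a)) = (sqn a / r ^+ 2)%R.
    by rewrite /sqn/=; field.
  by rewrite r2 divff.
rewrite (@ge0_integral_plane_cmul _ (cscale r^-1 (cconj a)))//; last 2 first.
- by rewrite sa oner_eq0.
- apply: (measurableT_comp mF); apply/measurable_fun_pair.
    exact: measurable_cmul.
  exact: measurable_sqn.
rewrite sa mul1e; apply: eq_integral => u _; congr (F (_, _)).
  have -> : cscale r u = cscale (sqn a / r) u by rewrite -r2 expr2 mulfK.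
  by rewrite /cmul/cscale/cconj/sqn/=; congr pair; field.
by rewrite sqn_cmul sa mul1r.
Qed.

(* Substitutes s = (a u + b v) / r for v, and then completes the square in u, with
   r = sqrt (|a|^2 + b^2). *)
Lemma rotation_plane (a : C2) (b : R) (F : C2 * R -> \bar R) : (0 <= b)%R ->
  measurable_fun setT F -> (forall p, 0 <= F p) ->
  \int[lam]_u \int[lam]_v F (cadd (cmul a u) (cscale b v), sqn u + sqn v)%R =
  \int[lam]_u \int[lam]_v
    F (cscale (Num.sqrt (sqn a + b ^+ 2)) u, sqn u + sqn v)%R.
Proof.
rewrite le_eqVlt => /orP[/eqP <-|b0] mF F0.
  (* For b = 0 no substitution in v is possible, but v enters only through its norm: integrated out
     first, it leaves a function of u to which a change of phase applies. *)
  have mF2 : measurable_fun setT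
      (fun p : C2 * R => \int[lam]_v F (p.1, p.2 + sqn v)%R).
    apply: (measurable_fun_fubini_tonelli_F
      (fun q : (C2 * R) * C2 => F (q.1.1, q.1.2 + sqn q.2)%R)) => //.
    apply: (measurableT_comp mF); apply/measurable_fun_pair => /=.
      exact: (measurableT_comp measurable_fst measurable_fst).
    apply: measurable_funD.
      exact: (measurableT_comp measurable_snd measurable_fst).
    exact: measurable_sqn_comp.
  rewrite expr0n/= addr0 -(@rotation_phase a _ mF2)/=; last first.
    by move=> p; apply: integral_ge0.
  apply: eq_integral => u _; apply: eq_integral => v _.
  by rewrite /cadd/cscale/= !mul0r !addr0.
set r := Num.sqrt _.
have r2 : (r ^+ 2 = sqn a + b ^+ 2)%R.
  by rewrite sqr_sqrtr// addr_ge0 ?sqn_ge0 ?sqr_ge0.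
have r0 : (0 < r)%R by rewrite sqrtr_gt0 ltr_wpDl ?sqn_ge0 ?exprn_gt0.
have rn0 : r != 0%R by rewrite gt_eqF.
have bn0 : b != 0%R by rewrite gt_eqF.
(* [V u s] is the v solving a u + b v = r s. [U s u] recentres u at conj(a) s / r^2 up to scaling,
   which is the completed square. The Jacobians (r/b)^2 and (b/r)^2 cancel. *)
pose V (u s : C2) := cadd (cscale (r / b) s) (cscale (- b^-1) (cmul a u)).
pose U (s u : C2) := cadd (cscale (b / r) u) (cscale r^-1 (cmul (cconj a) s)).
pose G (q : C2 * C2) := F (cscale r q.2, sqn q.1 + sqn (V q.1 q.2))%R.
have G0 q : 0 <= G q by exact: F0.
have mG : measurable_fun setT G.
  apply: (measurableT_comp mF); apply/measurable_fun_pair.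
    exact: measurable_cscale.
  apply: measurable_funD; apply: measurable_sqn_comp => //.
  apply: measurable_cadd; first exact: measurable_cscale.
  by apply: measurable_cscale => //; apply: measurable_cmul.
transitivity (((r / b) ^+ 2)%:E * \int[lam]_u \int[lam]_s G (u, s)).
  rewrite -ge0_integralZl//; last 3 first.
  - exact: (measurable_fun_fubini_tonelli_F G).
  - by move=> u _; apply: integral_ge0.
  - by rewrite lee_fin sqr_ge0.
  apply: eq_integral => u _.
  rewrite (@ge0_integral_plane_affine _ (r / b) (cscale (- b^-1) (cmul a u)))//;
    last 2 first.
  - by rewrite mulf_neq0// invr_eq0.
  - apply: (measurableT_comp mF); apply/measurable_fun_pair.
      by apply: measurable_cadd => //; exact: measurable_cscale.
    by apply: measurable_funD => //; exact: measurable_sqn.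
  congr (_ * _); apply: eq_integral => s _; congr (F (_, _)).
  by rewrite /cadd/cscale/cmul/=; congr pair; field.
rewrite (fubini_tonelli G)//.
transitivity (((r / b) ^+ 2)%:E * \int[lam]_s
    (((b / r) ^+ 2)%:E * \int[lam]_u F (cscale r s, sqn s + sqn u)%R)).
  congr (_ * _); apply: eq_integral => s _.
  rewrite (@ge0_integral_plane_affine _ (b / r)
    (cscale r^-1 (cmul (cconj a) s)) (fun u => G (u, s)))//; last 2 first.
  - by rewrite mulf_neq0// invr_eq0.
  - by apply: (measurableT_comp mG); exact/measurable_fun_pair.
  congr (_ * _); apply: eq_integral => u _; congr (F (_, _)).
  (* The pair ([U s u], [V (U s u) s]) is the image of (u, s) under the matrix with rows (b, conj a)
     / r and (-a, b) / r, unitary because r^2 = |a|^2 + b^2. Writing 1 as a quotient by r^2 leaves a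
     polynomial identity free of this relation. *)
  rewrite -[RHS]mul1r.
  rewrite (_ : 1%R = ((sqn a + b ^+ 2) / r ^+ 2)%R); last first.
    by rewrite -r2 divff// sqrf_eq0.
  have -> : V (U s u) s = cscale r^-1 (cadd (cscale b s) (cscale (-1) (cmul a u))).
    transitivity
      (cadd (cscale ((r ^+ 2 - sqn a) / b / r) s) (cscale (- r^-1) (cmul a u))).
      by rewrite /V /U /cadd/cscale/cmul/cconj/sqn/=; congr pair; field; exact/andP.
    rewrite r2 [(sqn a + _)%R]addrC addrK.
    by rewrite /cadd/cscale/cmul/=; congr pair; field; exact/andP.
  rewrite /U/cadd/cscale/cmul/cconj/sqn/=; field; exact: rn0.
rewrite ge0_integralZl//; last 3 first.
- pose H (q : C2 * C2) := F (cscale r q.1, sqn q.1 + sqn q.2)%R.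
  apply: (measurable_fun_fubini_tonelli_F H) => [|q]; last exact: F0.
  apply: (measurableT_comp mF); apply/measurable_fun_pair.
    exact: measurable_cscale.
  by apply: measurable_funD; apply: measurable_sqn_comp.
- by move=> s _; apply: integral_ge0.
- by rewrite lee_fin sqr_ge0.
by rewrite muleA -EFinM -exprMn mulrA mulfVK// divff// expr1n mul1e.
Qed.

Local Notation aff := (lebesgue_affine R).

Lemma ge0_integral_affine_space0 (f : 0.-tuple C2 -> \bar R) :
  measurable_fun setT f -> (forall u, 0 <= f u) ->
  \int[aff 0]_u f u = f [tuple].
Proof. by move=> mf f0; rewrite integral_dirac// diracT mul1e. Qed.

Lemma ge0_integral_affine_spaceS n (f : n.+1.-tuple C2 -> \bar R) :
  measurable_fun setT f -> (forall u, 0 <= f u) ->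
  \int[aff n.+1]_u f u = \int[lam]_x \int[aff n]_y f [tuple of x :: y].
Proof. exact: ge0_integral_measure_power_step. Qed.

Definition linear_form n (a u : n.-tuple C2) : C2 :=
  (\sum_(j < n) (cmul (tnth a j) (tnth u j)).1,
   \sum_(j < n) (cmul (tnth a j) (tnth u j)).2)%R.

Lemma linear_form_cons n x y (a u : n.-tuple C2) :
  linear_form [tuple of x :: a] [tuple of y :: u] =
  cadd (cmul x y) (linear_form a u).
Proof.
rewrite /linear_form !big_ord_recl !tnth0 /cadd; congr pair; congr (_ + _)%R;
by apply: eq_bigr => j _; rewrite !tnthS.
Qed.

Lemma sqnorm_affine_cons n x (u : n.-tuple C2) :
  sqnorm_affine [tuple of x :: u] = (sqn x + sqnorm_affine u)%R.
Proof.
rewrite /sqnorm_affine big_ord_recl tnth0; congr (_ + _)%R.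
by apply: eq_bigr => j _; rewrite !tnthS.
Qed.

Lemma measurable_linear_form n (a : n.-tuple C2) : measurable_fun setT (linear_form a).
Proof.
have m j : measurable_fun setT (fun u => cmul (tnth a j) (tnth u j)).
  by apply: measurable_cmul => //; exact: measurable_tnth.
apply/measurable_fun_pair; apply: measurable_sum => j.
  exact: (measurableT_comp measurable_fst (m j)).
exact: (measurableT_comp measurable_snd (m j)).
Qed.

Lemma measurable_thead n : measurable_fun setT (fun u : n.+1.-tuple C2 => thead u).
Proof. exact: measurable_tnth. Qed.

(* Unitary invariance of the Lebesgue measure in disguise: jointly with the norm, a linear
   form is distributed as a multiple of one coordinate. *)
Lemma rotation_affine n (a : n.+1.-tuple C2) (F : C2 * R -> \bar R) :
  measurable_fun setT F -> (forall p, 0 <= F p) ->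
  \int[aff n.+1]_u F (linear_form a u, sqnorm_affine u) =
  \int[aff n.+1]_u F (cscale (Num.sqrt (sqnorm_affine a)) (thead u), sqnorm_affine u).
Proof.
have mright m (c : R) (G : C2 * R -> \bar R) : measurable_fun setT G ->
    measurable_fun setT (fun u : m.+1.-tuple C2 =>
      G (cscale c (thead u), sqnorm_affine u)).
  move=> mG; apply: (measurableT_comp mG); apply/measurable_fun_pair.
    by apply: measurable_cscale => //; exact: measurable_thead.
  exact: measurable_sqnorm_affine.
have mleft m (b : m.-tuple C2) (G : C2 * R -> \bar R) : measurable_fun setT G ->
    measurable_fun setT (fun u => G (linear_form b u, sqnorm_affine u)).
  move=> mG; apply: (measurableT_comp mG); apply/measurable_fun_pair.
    exact: measurable_linear_form.
  exact: measurable_sqnorm_affine.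
elim: n a F => [|n IH] a F mF F0; case/tupleP: a => a0 a.
  rewrite (ge0_integral_affine_spaceS (mleft _ _ F mF) (fun=> F0 _)).
  rewrite (ge0_integral_affine_spaceS (mright _ _ F mF) (fun=> F0 _)).
  have sqnorm0 (v : 0.-tuple C2) : sqnorm_affine v = 0%R.
    by rewrite /sqnorm_affine big_ord0.
  transitivity (\int[lam]_x F (cmul a0 x, sqn x)).
    apply: eq_integral => x _; rewrite ge0_integral_affine_space0//=.
      rewrite linear_form_cons sqnorm_affine_cons sqnorm0 addr0 /linear_form !big_ord0.
      by rewrite /cadd/= !addr0.
    by apply: (measurableT_comp (mleft _ _ _ mF)); exact: measurable_cons.
  rewrite rotation_phase//; apply: eq_integral => x _.
  rewrite ge0_integral_affine_space0//=.
    by rewrite !sqnorm_affine_cons !sqnorm0 !addr0 /thead tnth0.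
  by apply: (measurableT_comp (mright _ _ _ mF)); exact: measurable_cons.
(* At fixed first coordinate x, the induction hypothesis replaces the form on the tail by r times
   one coordinate. *)
pose r := Num.sqrt (sqnorm_affine a).
transitivity (\int[lam]_x \int[aff n.+1]_y
    F (cadd (cmul a0 x) (cscale r (thead y)), sqn x + sqnorm_affine y)%R).
  rewrite (ge0_integral_affine_spaceS (mleft _ _ F mF) (fun=> F0 _)).
  apply: eq_integral => x _.
  have mFx : measurable_fun setT (fun p : C2 * R =>
      F (cadd (cmul a0 x) p.1, sqn x + p.2)%R).
    apply: (measurableT_comp mF); apply/measurable_fun_pair.
      exact: measurable_cadd.
    exact: measurable_funD.
  rewrite -(IH a _ mFx)//.
  by apply: eq_integral => y _; rewrite linear_form_cons sqnorm_affine_cons.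
(* The last n coordinates now enter only through their norm; integrated out into [F2], they leave a
   problem in two coordinates. *)
pose F2 (p : C2 * R) := \int[aff n]_w F (p.1, p.2 + sqnorm_affine w)%R.
have F20 p : 0 <= F2 p by apply: integral_ge0.
have mF2 : measurable_fun setT F2.
  apply: (measurable_fun_fubini_tonelli_F (fun q : (C2 * R) * n.-tuple C2 =>
    F (q.1.1, q.1.2 + sqnorm_affine q.2)%R)) => //.
  apply: (measurableT_comp mF); apply/measurable_fun_pair => /=.
    exact: (measurableT_comp measurable_fst measurable_fst).
  apply: measurable_funD.
    exact: (measurableT_comp measurable_snd measurable_fst).
  by apply: (measurableT_comp (@measurable_sqnorm_affine R n)).
transitivity (\int[lam]_x \int[lam]_z
    F2 (cadd (cmul a0 x) (cscale r z), sqn x + sqn z)%R).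
  apply: eq_integral => x _.
  have mFx : measurable_fun setT (fun y : n.+1.-tuple C2 =>
      F (cadd (cmul a0 x) (cscale r (thead y)), sqn x + sqnorm_affine y)%R).
    apply: (measurableT_comp mF); apply/measurable_fun_pair.
      apply: measurable_cadd => //.
      by apply: measurable_cscale => //; exact: measurable_thead.
    by apply: measurable_funD => //; exact: measurable_sqnorm_affine.
  rewrite (ge0_integral_affine_spaceS mFx (fun=> F0 _)).
  apply: eq_integral => z _; apply: eq_integral => w _.
  by rewrite sqnorm_affine_cons addrA /thead tnth0.
rewrite rotation_plane// ?sqrtr_ge0//.
rewrite sqr_sqrtr ?sqnorm_affine_ge0// -sqnorm_affine_cons.
rewrite (ge0_integral_affine_spaceS (mright _ _ F mF) (fun=> F0 _)).
apply: eq_integral => x _.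
have mx : measurable_fun setT (fun y : n.+1.-tuple C2 => [tuple of x :: y]).
  exact: measurable_cons.
rewrite (ge0_integral_affine_spaceS (measurableT_comp (mright _ _ F mF) mx)
  (fun=> F0 _)).
apply: eq_integral => z _; apply: eq_integral => w _.
rewrite /= [thead _](tnth0 x) [X in _ = F (_, X)]sqnorm_affine_cons.
by rewrite [in RHS](sqnorm_affine_cons z w) [(sqn x + (_ + _))%R]addrA.
Qed.

Lemma measurable_cmul_tuple n (a : C2) :
  measurable_fun setT (fun u : n.-tuple C2 => map_tuple (cmul a) u).
Proof.
apply/measurable_fun_tnthP => i.
rewrite (_ : _ \o _ = fun u => cmul a (tnth u i)).
  by apply: measurable_cmul => //; exact: measurable_tnth.
by apply/funext => u; rewrite /= tnth_map.
Qed.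

Lemma ge0_integral_affine_cmul n (a : C2) (f : n.-tuple C2 -> \bar R) :
  sqn a != 0%R -> measurable_fun setT f -> (forall u, 0 <= f u) ->
  \int[aff n]_u f u =
    (sqn a ^+ n)%:E * \int[aff n]_u f (map_tuple (cmul a) u).
Proof.
move=> a0; have sa0 m : 0 <= (sqn a ^+ m)%:E by rewrite lee_fin exprn_ge0// sqn_ge0.
elim: n f => [|n IH] f mf f0.
  rewrite !ge0_integral_affine_space0//.
    by rewrite expr0 mul1e; congr f; exact: val_inj.
  exact: (measurableT_comp mf (measurable_cmul_tuple _)).
pose g (p : C2 * n.-tuple C2) := f [tuple of p.1 :: map_tuple (cmul a) p.2].
have mg : measurable_fun setT g.
  apply: (measurableT_comp mf); apply: measurable_cons => //.
  by apply: (measurableT_comp (measurable_cmul_tuple a)).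
have g0 p : 0 <= g p by exact: f0.
transitivity (\int[lam]_x ((sqn a ^+ n)%:E * \int[aff n]_u g (x, u))).
  rewrite (ge0_integral_affine_spaceS mf f0); apply: eq_integral => x _.
  by rewrite IH//; apply: (measurableT_comp mf); exact: measurable_cons.
rewrite ge0_integralZl//; last 2 first.
- exact: (measurable_fun_fubini_tonelli_F g).
- by move=> x _; apply: integral_ge0.
rewrite (@ge0_integral_plane_cmul _ a (fun x => \int[aff n]_u g (x, u)))//; last 2 first.
- exact: (measurable_fun_fubini_tonelli_F g).
- by move=> x; apply: integral_ge0.
rewrite muleA -EFinM -exprSr; congr (_ * _).
rewrite (ge0_integral_affine_spaceS (measurableT_comp mf (measurable_cmul_tuple _))
  (fun=> f0 _)).
apply: eq_integral => x _; apply: eq_integral => u _.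
by congr f; exact: val_inj.
Qed.

End rotation.

(** * Integrals of radial functions *)

Section radial.
Context (R : realType).
Local Notation Rp := (measurableTypeR R).
Local Notation C2 := (Rp * Rp)%type.
Local Notation mu := (@lebesgue_measure R).
Local Notation lam := (lebesgue_plane R).
Local Notation aff := (lebesgue_affine R).
Local Open Scope ereal_scope.
Lemma measurable_sqn_preimage (A : set R) : measurable A ->
  measurable (@sqn R @^-1` A).
Proof. by move=> mA; rewrite -[_ @^-1` _]setTI; exact: measurable_sqn. Qed.

Local Notation disc q := (@sqn R @^-1` `]-oo, q%R]).

Lemma lebesgue_plane_indic (A : set C2) : measurable A ->
  lam A = \int[lam]_z (\1_A z)%:E.
Proof. by move=> mA; rewrite integral_indic// setIT. Qed.

Lemma lebesgue_plane_origin : lam [set (0, 0)%R] = 0.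
Proof.
rewrite (_ : [set _] = [set 0%R] `*` [set 0%R]); last first.
  by apply/seteqP; split => [_ ->//|[x y] [/= -> ->]].
rewrite [lam _](product_measure1E mu mu)//.
by rewrite [X in X * _](lebesgue_measure_set1 (0 : R)) mul0e.
Qed.

Lemma lebesgue_disc (q : R) : (0 <= q)%R -> lam (disc q) = q%:E * lam (disc 1).
Proof.
have md p : measurable (disc p) by exact: measurable_sqn_preimage.
rewrite le_eqVlt => /orP[/eqP <-|q0].
  rewrite mul0e (_ : disc 0 = [set (0, 0)%R]) ?lebesgue_plane_origin//.
  apply/seteqP; split => z /=; rewrite in_itv/=.
    by move=> z0; apply/eqP; rewrite -sqn_eq0 eq_le z0 sqn_ge0.
  by move=> ->; rewrite /sqn/= expr0n/= addr0.
have q2 : (Num.sqrt q ^+ 2 = q)%R by rewrite sqr_sqrtr// ltW.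
rewrite lebesgue_plane_indic//.
rewrite (@ge0_integral_plane_affine _ (Num.sqrt q) (0, 0)%R)//; last first.
- exact/measurable_EFinP.
- by rewrite gt_eqF// sqrtr_gt0.
rewrite q2 [in RHS]lebesgue_plane_indic//; congr (_ * _).
apply: eq_integral => z _; rewrite /= !addr0 !indicE; congr ((nat_of_bool _)%:R%:E).
apply/idP/idP; rewrite !inE/= !in_itv/= /sqn/= !exprMn q2 -mulrDr.
  by rewrite ger_pMr.
by rewrite ger_pMr.
Qed.

Lemma lebesgue_disc1_gt0 : 0 < lam (disc 1).
Proof.
apply: (@lt_le_trans _ _ (lam (`[0, 2^-1]%classic `*` `[0, 2^-1]%classic)%R)).
  rewrite [lam _](product_measure1E mu mu)//.
  rewrite [X in 0 < X * X](_ : _ = (2^-1)%:E).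
    by rewrite -EFinM lte_fin mulr_gt0// invr_gt0.
  by rewrite [LHS]lebesgue_measure_itv/= lte_fin invr_gt0 ltr0n -EFinB subr0.
apply: le_measure; rewrite ?inE//.
- exact: measurableX.
- exact: measurable_sqn_preimage.
move=> [x y]/=; rewrite !in_itv/= => -[/andP[x0 x1] /andP[y0 y1]].
by rewrite /sqn/=; nra.
Qed.

Lemma lebesgue_disc1_fin : lam (disc 1) \is a fin_num.
Proof.
rewrite ge0_fin_numE//.
apply: (@le_lt_trans _ _ (lam (`[-1, 1]%classic `*` `[-1, 1]%classic)%R)).
  apply: le_measure; rewrite ?inE//.
  - exact: measurable_sqn_preimage.
  - exact: measurableX.
  move=> [x y]/=; rewrite !in_itv/= /sqn/= => xy.
  by split; apply/andP; split; nra.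
rewrite [lam _](product_measure1E mu mu)//.
rewrite [X in X * X < _](_ : _ = 2%:E); first by rewrite -EFinM ltry.
by rewrite [LHS]lebesgue_measure_itv/= lte_fin (_ : (-1 < 1)%R) -?EFinB ?opprK //; lra.
Qed.

(* Its value is irrelevant: it cancels in the law of the overlap. *)
Definition disc_area : R := fine (lam (disc 1)).

Lemma disc_area_gt0 : (0 < disc_area)%R.
Proof.
apply: fine_gt0; rewrite lebesgue_disc1_gt0/=.
by rewrite -ge0_fin_numE// lebesgue_disc1_fin.
Qed.

Lemma lebesgue_discE (q : R) : lam (disc q) = (disc_area * Num.max q 0)%:E.
Proof.
have [q0|q0] := leP q 0%R.
  rewrite mulr0; have [->|q_neq0] := eqVneq q 0%R; first by rewrite lebesgue_disc// mul0e.
  rewrite (_ : disc q = set0) ?measure0//; apply/seteqP; split => // z /=.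
  by rewrite in_itv/= => zq; have := sqn_ge0 z; lra.
by rewrite lebesgue_disc ?ltW// mulrC EFinM fineK// lebesgue_disc1_fin.
Qed.

Lemma lebesgue_annulus (p q : R) : (p <= q)%R ->
  lam (@sqn R @^-1` `]p, q]%classic%R) =
  (disc_area * (Num.max q 0 - Num.max p 0))%:E.
Proof.
move=> pq; rewrite mulrBr EFinB -!lebesgue_discE.
have -> : @sqn R @^-1` `]p, q]%classic%R = disc q `\` disc p.
  apply/seteqP; split => z /=; rewrite !in_itv/=.
    by move=> /andP[pz zq]; split => //; apply/negP; rewrite -ltNge.
  by move=> [zq /negP]; rewrite -ltNge => ->.
have pq_disc : disc p `<=` disc q by move=> z /=; rewrite !in_itv/= => /le_trans; apply.
rewrite measureD; first by rewrite (setIidr pq_disc).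
- exact: measurable_sqn_preimage.
- exact: measurable_sqn_preimage.
- by rewrite [X in X < _](lebesgue_discE q) ltry.
Qed.

(** The discs {|z|^2 <= q} have area proportional to q, so |z|^2 pushes plane measure to a multiple
    of Lebesgue measure on the half-line. *)
Lemma ge0_integral_radial (h : R -> \bar R) :
  measurable_fun setT h -> (forall r, 0 <= h r) ->
  \int[lam]_z h (sqn z) = disc_area%:E * \int[mu]_(r in `[0%R, +oo[) h r.
Proof.
move=> mh h0; have c0 := disc_area_gt0.
have ci : (0 <= disc_area^-1)%R by rewrite invr_ge0 ltW.
have mN : measurable (`]-oo, 0[%classic%R : set Rp) by exact: measurable_itv.
pose m1 : {measure set Rp -> \bar R} :=
  mscale (NngNum ci) (pushforward lam (@sqn R : C2 -> Rp)).
(* The uniqueness theorem concerns measures on the whole line; [m2] supplies the negative half,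
   which the image measure misses. *)
pose m2 : {measure set Rp -> \bar R} := mrestr mu mN.
have msqn : measurable_fun setT (@sqn R : C2 -> Rp) by exact: measurable_sqn.
have E A : measurable A -> mu A = measure_add (m1 msqn) m2 A.
  move=> mA; apply: lebesgue_measure_unique => // {mA} _ [[p q]] _ <-.
  rewrite [RHS]measure_addE /m1 /m2 /= /mscale /mrestr /= /pushforward.
  have [qp|pq] := leP q p.
    rewrite set_itv_ge -?leNgt ?bnd_simp// preimage_set0 set0I !measure0.
    by rewrite mule0 adde0.
  rewrite lebesgue_annulus ?ltW// -EFinM mulKf ?gt_eqF//.
  rewrite [LHS]lebesgue_measure_itv/= lte_fin pq -EFinB.
  have [p0|p0] := leP 0%R p.
    rewrite (_ : _ `&` _ = set0) ?measure0; last first.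
      by apply/seteqP; split => z //=; rewrite !in_itv/= => -[/andP[pz _] z0]; lra.
    by rewrite max_l ?adde0// (le_trans p0)// ltW.
  have [q0|q0] := leP 0%R q.
    rewrite (_ : _ `&` _ = `]p, 0[%classic%R); last first.
      apply/seteqP; split => z //=; rewrite !in_itv/=.
        by move=> [/andP[-> _] ->].
      by move=> /andP[-> z0]; split => //=; lra.
    rewrite [X in _ + X]lebesgue_measure_itv/= lte_fin p0.
    by rewrite -EFinB -EFinD subr0 sub0r.
  rewrite (_ : _ `&` _ = `]p, q]%classic%R); last first.
    apply/seteqP; split => z //=; rewrite !in_itv/=.
      by move=> [].
    by move=> /andP[-> z0]; split => //=; lra.
  rewrite [X in _ + X]lebesgue_measure_itv/= lte_fin pq.
  by rewrite -EFinB -EFinD subrr add0r.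
rewrite (@eq_measure_integral _ _ _ _ (m1 msqn)); last first.
  move=> A mA A0; rewrite [LHS](E _ mA) [LHS]measure_addE /m2 /= /mrestr.
  rewrite (_ : A `&` _ = set0) ?measure0 ?adde0//.
  apply/seteqP; split => z //= -[/A0] /=; rewrite !in_itv/= andbT => z0 ?; lra.
rewrite ge0_integral_mscale//; last exact: measurable_funS mh.
rewrite ge0_integral_pushforward//; last exact: measurable_funS mh.
rewrite muleA -EFinM divff ?gt_eqF// mul1e.
rewrite (_ : _ @^-1` _ = setT)//; apply/seteqP; split => // z _ /=.
by rewrite in_itv/= andbT sqn_ge0.
Qed.

End radial.

(** * Beta integrals and two evaluations of an integral over the unit ball *)

Section law.
Context (R : realType).
Local Notation Rp := (measurableTypeR R).
Local Notation C2 := (Rp * Rp)%type.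
Local Notation mu := (@lebesgue_measure R).
Local Notation lam := (lebesgue_plane R).
Local Notation aff := (lebesgue_affine R).
Local Notation area := (disc_area R).
Local Open Scope ereal_scope.

(** The truncated power; [ppow 0] is the indicator of the positive reals. Domains are thus encoded
    in the integrands, and all integrals run over the whole line, where affine substitutions and
    Tonelli apply directly. *)
Definition ppow n (r : R) : R := ((0 < r)%R%:R * r ^+ n)%R.

Lemma ppow_ge0 n r : (0 <= ppow n r)%R.
Proof.
by rewrite /ppow; case: (ltP 0%R r) => [r0|_]; rewrite ?mul0r// mul1r exprn_ge0// ltW.
Qed.

Lemma ppow_gt0E n r : (0 < r)%R -> ppow n r = (r ^+ n)%R.
Proof. by rewrite /ppow => ->; rewrite mul1r. Qed.

Lemma ppow_le0E n r : (r <= 0)%R -> ppow n r = 0%R.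
Proof. by rewrite /ppow leNgt => /negbTE ->; rewrite mul0r. Qed.

Lemma ppowM n r s : (0 < r)%R -> ppow n (r * s) = (r ^+ n * ppow n s)%R.
Proof. by move=> r0; rewrite /ppow pmulr_rgt0// exprMn mulrCA. Qed.

Lemma measurable_ppow n : measurable_fun setT (ppow n).
Proof.
apply: measurable_funM; last exact: measurable_funX.
rewrite (_ : (fun r => _) = \1_(`]0%R, +oo[%classic : set R)).
  by apply: measurable_indic; exact: measurable_itv.
apply/funext => r; rewrite indicE; congr (nat_of_bool _)%:R%R.
by rewrite mem_setE in_itv/= andbT.
Qed.

Lemma measurable_ppow_comp d (T : measurableType d) n (f : T -> R) :
  measurable_fun setT f -> measurable_fun setT (fun x => (ppow n (f x))%:E).
Proof.
by move=> mf; apply/measurable_EFinP; apply: (measurableT_comp (measurable_ppow n)).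
Qed.

Lemma ge0_integral_planeE (h : R -> \bar R) :
  measurable_fun setT h -> (forall r, 0 <= h r) ->
  \int[lam]_z h (sqn z) = area%:E * \int[mu]_r ((ppow 0 r)%:E * h r).
Proof.
move=> mh h0; rewrite ge0_integral_radial//; congr (_ * _).
rewrite -integral_itv_obnd_cbnd; last exact: measurable_funS mh.
rewrite integral_mkcond; apply: eq_integral => r _.
rewrite patchE mem_setE in_itv/= andbT.
case: ltP => r0; first by rewrite ppow_gt0E// expr0 mul1e.
by rewrite ppow_le0E// mul0e.
Qed.

(** Substituting s = r t, the factor r^(n+1) collects n powers from [ppow n] and one from the
    differential. For r <= 0 both sides vanish. *)
Lemma ge0_integral_ppow_scale n (r : R) (h : R -> \bar R) :
  measurable_fun setT h -> (forall r, 0 <= h r) ->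
  \int[mu]_s ((ppow 0 s)%:E * (ppow n (r - s))%:E * h (s / r)%R) =
  (ppow n.+1 r)%:E * \int[mu]_t ((ppow 0 t)%:E * (ppow n (1 - t))%:E * h t).
Proof.
move=> mh h0; have [r0|r0] := leP r 0%R.
  rewrite ppow_le0E// mul0e integral0_eq// => s _.
  have [s0|s0] := leP s 0%R; first by rewrite ppow_le0E// !mul0e.
  by rewrite [ppow n _]ppow_le0E ?mule0 ?mul0e//; lra.
rewrite ppow_gt0E// (@ge0_integral_affine _ r 0%R); last 3 first.
- by rewrite gt_eqF.
- apply: emeasurable_funM.
    apply: emeasurable_funM; apply: measurable_ppow_comp => //.
    exact: measurable_funB.
  by apply: (measurableT_comp mh); apply: measurable_funM.
- by move=> x; rewrite !mule_ge0// lee_fin ppow_ge0.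
rewrite gtr0_norm// exprS EFinM -muleA; congr (_ * _).
rewrite -ge0_integralZl//; last 3 first.
- apply: emeasurable_funM => //.
  apply: emeasurable_funM; apply: measurable_ppow_comp => //.
  exact: measurable_funB.
- by move=> x _; rewrite !mule_ge0// lee_fin ppow_ge0.
- by rewrite lee_fin exprn_ge0// ltW.
apply: eq_integral => t _.
have -> : (r - (r * t + 0) = r * (1 - t))%R by ring.
rewrite addr0 !ppowM// expr0 mul1r (EFinM (r ^+ n)%R) [(r * t)%R]mulrC mulfK ?gt_eqF//.
by rewrite !muleA [X in X * _ * _ = _]muleC.
Qed.

(** [XMonemX 0 n t] is (1 - t)^n, the beta integrand. The truncations cut out the open unit
    interval, and the endpoints are null. *)
Lemma integral_ppow_beta n (h : R -> \bar R) :
  measurable_fun setT h -> (forall r, 0 <= h r) ->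
  \int[mu]_t ((ppow 0 t)%:E * (ppow n (1 - t))%:E * h t) =
  \int[mu]_(t in `[0%R, 1%R]) ((XMonemX 0 n t)%:E * h t).
Proof.
move=> mh h0.
have mX (D : set R) : measurable D ->
    measurable_fun D (fun t : R => (XMonemX 0 n t)%:E * h t).
  move=> mD; apply: emeasurable_funM; last exact: measurable_funS mh.
  by apply/measurable_EFinP; exact: measurable_XMonemX.
rewrite -integral_itv_obnd_cbnd; last exact: mX.
rewrite -integral_itv_bndo_bndc; last exact: mX.
rewrite [RHS]integral_mkcond; apply: eq_integral => t _.
rewrite patchE mem_setE in_itv/= XMonemX0n.
have [t0|t0] := ltP 0%R t; last by rewrite ppow_le0E// !mul0e.
have [t1|t1] := ltP t 1%R; last by rewrite [ppow n _]ppow_le0E ?mule0 ?mul0e//; lra.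
by rewrite !ppow_gt0E ?subr_gt0// expr0 mul1e.
Qed.

Lemma integral_ppow0 n :
  \int[mu]_t ((ppow 0 t)%:E * (ppow n (1 - t))%:E) = (n.+1%:R^-1)%:E.
Proof.
rewrite -(beta_fun1Sn n) EFin_beta_fun.
transitivity (\int[mu]_t ((ppow 0 t)%:E * (ppow n (1 - t))%:E * (cst 1 t)) : \bar R).
  by apply: eq_integral => t _; rewrite mule1.
rewrite (integral_ppow_beta n (h := cst 1))//.
rewrite [LHS]integral_mkcond; apply: eq_integral => t _.
by rewrite !patchE; case: ifP => // _; rewrite mule1.
Qed.

Lemma integral_ppow1 n :
  \int[mu]_t ((ppow 0 (1 - t))%:E * (ppow n t)%:E) = (n.+1%:R^-1)%:E.
Proof.
rewrite -integral_ppow0 (@ge0_integral_affine _ (-1) 1%R); last 3 first.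
- by rewrite oppr_eq0 oner_eq0.
- apply: emeasurable_funM; apply: measurable_ppow_comp => //.
  exact: measurable_funB.
- by move=> x; rewrite !mule_ge0// lee_fin ppow_ge0.
rewrite normrN1 mul1e; apply: eq_integral => t _.
by congr ((ppow _ _)%:E * (ppow _ _)%:E); ring.
Qed.

(** The density of |u|^2 on C^(n+1) at r > 0 is this constant times r^n. *)
Definition radial_constant n : R := (area ^+ n.+1 / n`!%:R)%R.

Lemma radial_constant_gt0 n : (0 < radial_constant n)%R.
Proof. by rewrite divr_gt0// ?exprn_gt0 ?disc_area_gt0// ltr0n fact_gt0. Qed.

(** The radial formula on C^(n+1) is a hypothesis, so that the lemma can serve in the induction
    proving this formula as well as after it. Here s is |x|^2 and r the total squared norm; their
    joint density is proportional to (r - s)^n on 0 < s < r. *)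
Lemma ge0_integral_radial_split n (Phi : C2 -> \bar R) :
  (forall h : R -> \bar R, measurable_fun setT h -> (forall r, 0 <= h r) ->
    \int[aff n.+1]_u h (sqnorm_affine u) =
    (radial_constant n)%:E * \int[mu]_r ((ppow n r)%:E * h r)) ->
  measurable_fun setT Phi -> (forall p, 0 <= Phi p) ->
  \int[lam]_x \int[aff n.+1]_u Phi (sqn x, sqn x + sqnorm_affine u)%R =
  (area * radial_constant n)%:E *
    \int[mu]_r \int[mu]_s ((ppow 0 s)%:E * (ppow n (r - s))%:E * Phi (s, r)).
Proof.
move=> IH mPhi Phi0; have K0 : 0 <= (radial_constant n)%:E.
  by rewrite lee_fin ltW// radial_constant_gt0.
pose P (q : C2) := (ppow n (q.2 - q.1))%:E * Phi q.
have mP : measurable_fun setT P.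
  apply: emeasurable_funM => //; apply: measurable_ppow_comp.
  exact: measurable_funB.
have P0 q : 0 <= P q by rewrite mule_ge0// lee_fin ppow_ge0.
pose P1 (q : C2) := (ppow 0 q.1)%:E * P q.
have mP1 : measurable_fun setT P1.
  by apply: emeasurable_funM => //; apply: measurable_ppow_comp.
have P10 q : 0 <= P1 q by rewrite mule_ge0// lee_fin ppow_ge0.
have mFP : measurable_fun setT (fun s : Rp => \int[mu]_r P (s, r)).
  exact: (measurable_fun_fubini_tonelli_F P).
have FP0 s : 0 <= \int[mu]_r P (s, r) by exact: integral_ge0.
transitivity (\int[lam]_x ((radial_constant n)%:E * \int[mu]_r P (sqn x, r))).
  apply: eq_integral => x _.
  have mPx : measurable_fun setT (fun r : Rp => Phi (sqn x, sqn x + r)%R).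
    apply: (measurableT_comp mPhi); apply/measurable_fun_pair => //.
    exact: measurable_funD.
  rewrite (IH (fun r => Phi (sqn x, sqn x + r)%R))//.
  congr (_ * _); rewrite -(@ge0_integral_shift _ (- sqn x)); last 2 first.
  - by apply: emeasurable_funM => //; exact: measurable_ppow_comp.
  - by move=> r; rewrite mule_ge0// lee_fin ppow_ge0.
  by apply: eq_integral => r _; rewrite /P /= subrKC.
rewrite (@ge0_integral_planeE (fun s => (radial_constant n)%:E * \int[mu]_r P (s, r)));
  last 2 first.
- exact: emeasurable_funM.
- by move=> s; rewrite mule_ge0.
rewrite (EFinM area) -muleA; congr (_ * _).
transitivity (\int[mu]_s ((radial_constant n)%:E * \int[mu]_r P1 (s, r))).
  apply: eq_integral => s _; rewrite muleCA; congr (_ * _).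
  rewrite -ge0_integralZl//; last 2 first.
  - by apply: (measurableT_comp mP); exact/measurable_fun_pair.
  - by rewrite lee_fin ppow_ge0.
rewrite ge0_integralZl; first last.
- exact: K0.
- by move=> s _; exact: integral_ge0.
- exact: (measurable_fun_fubini_tonelli_F P1).
- exact: measurableT.
congr (_ * _); rewrite (fubini_tonelli P1 mP1 P10); apply: eq_integral => r _.
by apply: eq_integral => s _; rewrite /P1 /P muleA.
Qed.

(** Adding one complex coordinate convolves the density r^n with the constant density on the
    half-line, which gives r^(n+1) / (n+1) and hence the factorial. *)
Lemma ge0_integral_affine_radial n (h : R -> \bar R) :
  measurable_fun setT h -> (forall r, 0 <= h r) ->
  \int[aff n.+1]_u h (sqnorm_affine u) =
  (radial_constant n)%:E * \int[mu]_r ((ppow n r)%:E * h r).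
Proof.
elim: n h => [|n IH] h mh h0.
  rewrite /radial_constant expr1 divr1 -ge0_integral_planeE//.
  have m1 : measurable_fun setT (fun u : 1.-tuple C2 => h (sqnorm_affine u)).
    exact: (measurableT_comp mh (@measurable_sqnorm_affine R 1)).
  rewrite (ge0_integral_affine_spaceS m1)//; apply: eq_integral => x _.
  rewrite ge0_integral_affine_space0//.
    by rewrite sqnorm_affine_cons /sqnorm_affine big_ord0 addr0.
  by apply: (measurableT_comp m1); exact: measurable_cons.
have m1 : measurable_fun setT (fun u : n.+2.-tuple C2 => h (sqnorm_affine u)).
  exact: (measurableT_comp mh (@measurable_sqnorm_affine R n.+2)).
rewrite (ge0_integral_affine_spaceS m1)//.
transitivity (\int[lam]_x \int[aff n.+1]_u h (sqn x + sqnorm_affine u)%R).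
  apply: eq_integral => x _; apply: eq_integral => u _.
  by rewrite sqnorm_affine_cons.
rewrite (@ge0_integral_radial_split n (fun p => h p.2))//;
  last exact: (measurableT_comp mh).
have -> : (area * radial_constant n = radial_constant n.+1 * n.+1%:R)%R.
  rewrite /radial_constant factS natrM [in RHS]exprS; field.
  by rewrite -[1%R]/(1%:R) -natrD !pnatr_eq0 -lt0n fact_gt0.
rewrite (EFinM (radial_constant n.+1)) -muleA; congr (_ * _).
have mI : measurable_fun setT (fun r : Rp => (ppow n.+1 r)%:E * h r).
  by apply: emeasurable_funM => //; exact: measurable_ppow_comp.
transitivity (n.+1%:R%:E * \int[mu]_r (n.+1%:R^-1%:E * ((ppow n.+1 r)%:E * h r))).
  congr (_ * _); apply: eq_integral => r _.
  rewrite (@ge0_integral_ppow_scale n r (cst (h r)))//= muleCA; congr (_ * _).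
  rewrite ge0_integralZr//; last 2 first.
  - apply: emeasurable_funM; apply: measurable_ppow_comp => //.
    exact: measurable_funB.
  - by move=> t _; rewrite mule_ge0// lee_fin ppow_ge0.
  by rewrite integral_ppow0.
rewrite (@ge0_integralZl _ _ _ mu _ measurableT _ mI); last 2 first.
- by move=> r _; rewrite mule_ge0// lee_fin ppow_ge0.
- by rewrite lee_fin invr_ge0.
by rewrite muleA -EFinM divff ?mul1e// pnatr_eq0.
Qed.

(** [powR] with exponent -1 agrees with the inverse on nonnegative reals; x (x^2)^(-1) extends this
    to all signs, and to 0, where the inverse is 0. *)
Lemma measurable_invr : measurable_fun setT (fun x : R => x^-1%R).
Proof.
rewrite (_ : (fun x : R => _) = fun x => (x * (x ^+ 2) `^ (-1))%R); last first.
  apply/funext => x; rewrite powR_inv1 ?sqr_ge0//.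
  by have [->|x0] := eqVneq x 0%R; [rewrite invr0 mul0r|field].
apply: measurable_funM => //.
by apply: (measurableT_comp (@measurable_powR R (-1))); exact: measurable_funX.
Qed.

(** At q = (|<a,u>|^2, |u|^2) this is h of the overlap of a unit vector a with u, cut off to the
    open unit ball. *)
Definition ball_weight (h : R -> \bar R) (q : C2) :=
  h (q.1 / q.2)%R * (ppow 0 (1 - q.2))%:E.

Lemma measurable_ball_weight h : measurable_fun setT h ->
  measurable_fun setT (ball_weight h).
Proof.
move=> mh; apply: emeasurable_funM.
  apply: (measurableT_comp mh); apply: measurable_funM => //.
  by apply: (measurableT_comp measurable_invr).
by apply: measurable_ppow_comp; exact: measurable_funB.
Qed.

Lemma ball_weight_ge0 h q : (forall r, 0 <= h r) -> 0 <= ball_weight h q.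
Proof. by move=> h0; rewrite mule_ge0// lee_fin ppow_ge0. Qed.

(** After rotation the overlap is s / r with s = |u_0|^2 and r = |u|^2. By scaling, the integral
    over s is r^(n+1) times the beta integral, and the integral of r^(n+1) over the unit interval is
    1 / (n+2). *)
Lemma ball_integral_rotation n (h : R -> \bar R) (a : n.+2.-tuple C2) :
  sqnorm_affine a = 1%R -> measurable_fun setT h -> (forall r, 0 <= h r) ->
  \int[aff n.+2]_u ball_weight h (sqn (linear_form a u), sqnorm_affine u) =
  (area * radial_constant n * n.+2%:R^-1)%:E *
    \int[mu]_t ((ppow 0 t)%:E * (ppow n (1 - t))%:E * h t).
Proof.
move=> a1 mh h0.
have mW := measurable_ball_weight mh.
have W0 q := ball_weight_ge0 q h0.
pose F (p : C2 * R) := ball_weight h (sqn p.1, p.2).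
have mF : measurable_fun setT F.
  apply: (measurableT_comp mW); apply/measurable_fun_pair => //=.
  exact: measurable_sqn_comp.
transitivity (\int[aff n.+2]_u F (cscale 1 (thead u), sqnorm_affine u)).
  have := rotation_affine a mF (fun p => W0 _); rewrite a1 sqrtr1; exact.
have F0 p : 0 <= F p by exact: W0.
rewrite ge0_integral_affine_spaceS//; last first.
  apply: (measurableT_comp mF); apply/measurable_fun_pair.
    by apply: measurable_cscale => //; exact: measurable_thead.
  exact: measurable_sqnorm_affine.
transitivity (\int[lam]_x \int[aff n.+1]_u
    ball_weight h (sqn x, sqn x + sqnorm_affine u)%R).
  apply: eq_integral => x _; apply: eq_integral => u _.
  rewrite /F /= sqnorm_affine_cons [thead _](tnth0 x); congr (ball_weight h (_, _)).
  by rewrite /sqn/= !mul1r.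
rewrite (ge0_integral_radial_split (@ge0_integral_affine_radial n) mW)//.
rewrite [in RHS](EFinM (area * radial_constant n)%R) -muleA; congr (_ * _).
set I := \int[mu]_t ((ppow 0 t)%:E * (ppow n (1 - t))%:E * h t); have I0 : 0 <= I.
  by apply: integral_ge0 => t _; rewrite !mule_ge0// lee_fin ppow_ge0.
transitivity (\int[mu]_r ((ppow 0 (1 - r))%:E * (ppow n.+1 r)%:E * I)); last first.
  rewrite ge0_integralZr//; last 2 first.
  - apply: emeasurable_funM; apply: measurable_ppow_comp => //.
    exact: measurable_funB.
  - by move=> t _; rewrite mule_ge0// lee_fin ppow_ge0.
  by rewrite integral_ppow1.
apply: eq_integral => r _; rewrite -muleA.
rewrite -(ge0_integral_ppow_scale n r mh h0).
rewrite -ge0_integralZl//; last 3 first.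
- apply: emeasurable_funM.
    apply: emeasurable_funM; apply: measurable_ppow_comp => //.
    exact: measurable_funB.
  by apply: (measurableT_comp mh); exact: measurable_funM.
- by move=> s _; rewrite !mule_ge0// lee_fin ppow_ge0.
- by rewrite lee_fin ppow_ge0.
by apply: eq_integral => s _; rewrite /ball_weight/= [RHS]muleC muleA.
Qed.

Lemma integral_ppow1_scale n (s : R) : (0 < s)%R ->
  \int[mu]_r ((ppow 0 (1 - r * s))%:E * (ppow n r)%:E) =
  (n.+1%:R^-1 * s ^- n.+1)%:E.
Proof.
move=> s0; have si0 : (0 < s^-1)%R by rewrite invr_gt0.
rewrite (@ge0_integral_affine _ s^-1 0%R); last 3 first.
- by rewrite gt_eqF.
- apply: emeasurable_funM; apply: measurable_ppow_comp => //.
  by apply: measurable_funB => //; exact: measurable_funM.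
- by move=> x; rewrite !mule_ge0// lee_fin ppow_ge0.
rewrite gtr0_norm//.
transitivity (s^-1%:E *
  \int[mu]_r ((s^-1 ^+ n)%:E * ((ppow 0 (1 - r))%:E * (ppow n r)%:E))).
  congr (_ * _); apply: eq_integral => r _.
  rewrite addr0 ppowM// (EFinM (s^-1 ^+ n)%R) muleCA; congr (_ * (_%:E * _)).
  by congr ppow; field; rewrite gt_eqF.
rewrite ge0_integralZl//; last 3 first.
- apply: emeasurable_funM; apply: measurable_ppow_comp => //.
  exact: measurable_funB.
- by move=> x _; rewrite !mule_ge0// lee_fin ppow_ge0.
- by rewrite lee_fin exprn_ge0// ltW.
by rewrite integral_ppow1 muleA -!EFinM -exprS exprVn mulrC.
Qed.

Definition affine_one n (w : n.-tuple C2) : n.+1.-tuple C2 :=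
  [tuple of ((1, 0)%R : C2) :: w].

Lemma measurable_affine_one n : measurable_fun setT (@affine_one n).
Proof. exact: measurable_cons. Qed.

Lemma linear_form_cmul n (a u : n.-tuple C2) x :
  linear_form a (map_tuple (cmul x) u) = cmul x (linear_form a u).
Proof.
rewrite /linear_form [RHS]/cmul/= !mulr_sumr -sumrB -big_split/=.
by congr pair; apply: eq_bigr => j _; rewrite tnth_map /cmul/=; ring.
Qed.

Lemma map_affine_one n (w : n.-tuple C2) x :
  map_tuple (cmul x) (affine_one w) = [tuple of x :: map_tuple (cmul x) w].
Proof.
apply: val_inj => /=; congr cons; case: x => x y.
by rewrite /cmul/= !mulr1 !mulr0 subr0 add0r.
Qed.

Lemma sqnorm_affine_cmul n (u : n.-tuple C2) x :
  sqnorm_affine (map_tuple (cmul x) u) = (sqn x * sqnorm_affine u)%R.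
Proof.
rewrite /sqnorm_affine mulr_sumr; apply: eq_bigr => j _.
by rewrite tnth_map -[LHS]/(sqn _) sqn_cmul.
Qed.

Lemma sqnorm_affine_one n (w : n.-tuple C2) :
  sqnorm_affine (affine_one w) = (1 + sqnorm_affine w)%R.
Proof. by rewrite sqnorm_affine_cons /sqn/= expr1n expr0n/= addr0. Qed.

(* Substitutes u = x (1, w): all points u of a complex line have the same overlap. *)
Lemma ball_integral_chart n (h : R -> \bar R) (a : n.+1.-tuple C2) :
  measurable_fun setT h -> (forall r, 0 <= h r) ->
  \int[aff n.+1]_u ball_weight h (sqn (linear_form a u), sqnorm_affine u) =
  (area * n.+1%:R^-1)%:E *
  \int[aff n]_w (h (sqn (linear_form a (affine_one w)) / (1 + sqnorm_affine w))%R
     * ((1 + sqnorm_affine w) ^- n.+1)%:E).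
Proof.
move=> mh h0.
have mW := measurable_ball_weight mh.
have W0 q := ball_weight_ge0 q h0.
have mWa : measurable_fun setT
   (fun u => ball_weight h (sqn (linear_form a u), sqnorm_affine u)).
  apply: (measurableT_comp mW); apply/measurable_fun_pair => //=.
    by apply: measurable_sqn_comp; exact: measurable_linear_form.
  exact: measurable_sqnorm_affine.
pose s (w : n.-tuple C2) : R := (1 + sqnorm_affine w)%R.
pose t (w : n.-tuple C2) : R := (sqn (linear_form a (affine_one w)) / s w)%R.
have s0 w : (0 < s w)%R by rewrite ltr_wpDr ?sqnorm_affine_ge0.
have ms : measurable_fun setT s.
  by apply: measurable_funD => //; exact: measurable_sqnorm_affine.
have mt : measurable_fun setT t.
  apply: measurable_funM.
    apply: measurable_sqn_comp; apply: (measurableT_comp (@measurable_linear_form R _ a)).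
    exact: measurable_affine_one.
  exact: (measurableT_comp measurable_invr).
pose G (q : C2 * n.-tuple C2) :=
  h (t q.2) * ((sqn q.1 ^+ n)%:E * (ppow 0 (1 - sqn q.1 * s q.2))%:E).
have G0 q : 0 <= G q.
  by rewrite !mule_ge0// lee_fin ?ppow_ge0// exprn_ge0// sqn_ge0.
have mG : measurable_fun setT G.
  apply: emeasurable_funM.
    by apply: (measurableT_comp mh); exact: (measurableT_comp mt).
  apply: emeasurable_funM.
    by apply/measurable_EFinP; apply: measurable_funX; exact: measurable_sqn_comp.
  apply: measurable_ppow_comp; apply: measurable_funB => //.
  apply: measurable_funM; first exact: measurable_sqn_comp.
  exact: (measurableT_comp ms).
pose f (q : C2 * n.-tuple C2) :=
  let u := [tuple of q.1 :: q.2] in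
  ball_weight h (sqn (linear_form a u), sqnorm_affine u).
have f0 q : 0 <= f q by exact: W0.
have mf : measurable_fun setT f by apply: (measurableT_comp mWa); exact: measurable_cons.
rewrite ge0_integral_affine_spaceS//.
(* Rescaling the last n coordinates by x has Jacobian |x|^(2n) and requires x to be nonzero, whence
   an equality for almost every x only. *)
transitivity (\int[lam]_x \int[aff n]_w G (x, w)).
  apply: (@ge0_ae_eq_integral _ _ _ lam setT (fun x => \int[aff n]_w f (x, w))
    (fun x => \int[aff n]_w G (x, w))) => //.
  - exact: (measurable_fun_fubini_tonelli_F f).
  - exact: (measurable_fun_fubini_tonelli_F G).
  - by move=> x _; exact: integral_ge0.
  - by move=> x _; exact: integral_ge0.
  have o1 : @sqn R @^-1` [set 0%R] = [set (0, 0)%R].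
    apply/seteqP; split => z /=; first by move/eqP; rewrite sqn_eq0 => /eqP.
    by move=> ->; apply/eqP; rewrite sqn_eq0.
  exists [set (0, 0)%R]; split.
  - by rewrite -o1; exact: measurable_sqn_preimage.
  - exact: lebesgue_plane_origin.
  move=> x /= /not_implyP[_]; apply: contra_notP => xn0.
  have {}xn0 : sqn x != 0%R by rewrite sqn_eq0; apply/eqP.
  rewrite (@ge0_integral_affine_cmul _ _ x (fun w => f (x, w)))//; last first.
    by apply: (measurableT_comp mf); exact/measurable_fun_pair.
  rewrite -ge0_integralZl//; last 2 first.
  - apply: (measurableT_comp mf); apply/measurable_fun_pair => //.
    exact: measurable_cmul_tuple.
  - by rewrite lee_fin exprn_ge0// sqn_ge0.
  apply: eq_integral => w _.
  rewrite /f /= -map_affine_one linear_form_cmul sqnorm_affine_cmul sqnorm_affine_one.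
  rewrite sqn_cmul /ball_weight /G /= muleCA; congr (h _ * _).
  by rewrite -mulf_div divff// mul1r.
rewrite (fubini_tonelli G)// -ge0_integralZl//; last 3 first.
- apply: emeasurable_funM; first exact: (measurableT_comp mh).
  apply/measurable_EFinP; apply: (measurableT_comp measurable_invr).
  exact: measurable_funX.
- by move=> w _; rewrite mule_ge0// lee_fin invr_ge0 exprn_ge0// ltW// s0.
- by rewrite lee_fin mulr_ge0// ?invr_ge0// ltW// disc_area_gt0.
apply: eq_integral => w _; rewrite muleCA.
(* At fixed w the point x ranges over a disc of squared radius 1 / (1 + |w|^2); integrating |x|^(2n)
   over it produces the Fubini-Study density. The absolute value makes [g] nonnegative on the whole
   line. *)
pose g (r : R) := (`|r| ^+ n)%:E * (ppow 0 (1 - r * s w))%:E.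
have mg : measurable_fun setT g.
  apply: emeasurable_funM.
    by apply/measurable_EFinP; apply: measurable_funX; exact: normr_measurable.
  apply: measurable_ppow_comp; apply: measurable_funB => //.
  exact: measurable_funM.
have g0 r : 0 <= g r by rewrite mule_ge0// lee_fin ?ppow_ge0// exprn_ge0.
transitivity (h (t w) * \int[lam]_x g (sqn x)).
  rewrite -ge0_integralZl//; last exact: (measurableT_comp mg (@measurable_sqn R)).
  by apply: eq_integral => x _; rewrite /G /g ger0_norm// sqn_ge0.
congr (_ * _); rewrite ge0_integral_planeE//.
transitivity (area%:E * \int[mu]_r ((ppow 0 (1 - r * s w))%:E * (ppow n r)%:E)).
  congr (_ * _); apply: eq_integral => r _.
  rewrite /g muleA [RHS]muleC; congr (_ * _); rewrite -EFinM; congr EFin.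
  rewrite /ppow expr0 mulr1; case: (ltP 0%R r) => r0; last by rewrite !mul0r.
  by rewrite gtr0_norm.
by rewrite (integral_ppow1_scale n (s0 w)) -!EFinM mulrA.
Qed.

End law.

(** * The law of the overlap *)

Section overlap.
Context (R : realType).
Local Notation Rp := (measurableTypeR R).
Local Notation C2 := (Rp * Rp)%type.
Local Notation mu := (@lebesgue_measure R).
Local Notation aff := (lebesgue_affine R).
Local Open Scope ereal_scope.

(** The two evaluations of the ball integral are equated and their common factor area / (n+2) is
    divided out. The result does not depend on the unit vector [a], which is the invariance
    needed. *)
Lemma affine_line_law n (h : R -> \bar R) (a : n.+2.-tuple C2) :
  sqnorm_affine a = 1%R -> measurable_fun setT h -> (forall r, 0 <= h r) ->
  \int[aff n.+1]_w (h (sqn (linear_form a (affine_one w)) / (1 + sqnorm_affine w))%R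
     * ((1 + sqnorm_affine w) ^- n.+2)%:E) =
  (radial_constant R n)%:E * \int[mu]_(t in `[0%R, 1%R]) ((XMonemX 0 n t)%:E * h t).
Proof.
move=> a1 mh h0; rewrite -integral_ppow_beta//.
have := ball_integral_rotation a1 mh h0; rewrite ball_integral_chart//.
rewrite mulrAC (EFinM (disc_area R / _)%R) -muleA.
move=> /(congr1 (mule (disc_area R / n.+2%:R)^-1%:E)).
have c0 : (0 < disc_area R / n.+2%:R)%R by rewrite divr_gt0// disc_area_gt0.
by rewrite !muleA -EFinM mulVf ?gt_eqF// !mul1e.
Qed.

Section projective.
Variable d : nat.
Local Notation CP := (projective_space R d).
Implicit Types (p q : CP).

Definition overlap p q : R := (coherence (vpick p) (vpick q) ^+ 2)%R.

(** [linear_form] is bilinear whereas [dotmx] is conjugate-linear in its second argument.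
    Conjugating the coefficients yields the conjugate of [dotmx], which has the same modulus. *)
Definition conj_pair (z : R[i]) : C2 := (complex.Re z, - complex.Im z)%R.

Definition row_form (u : 'rV[R[i]]_(1 + d)) : d.+1.-tuple C2 :=
  [tuple of conj_pair (u 0%R (lshift d 0%R)) ::
    [tuple conj_pair (u 0%R (rshift 1 j)) | j < d]].

Lemma sqn_conj_pair z : (sqn (conj_pair z))%:C%C = (`|z| ^+ 2)%R :> R[i].
Proof. by rewrite -add_Re2_Im2 /sqn/= sqrrN. Qed.

Lemma sqnorm_row_form (u : 'rV[R[i]]_(1 + d)) :
  (sqnorm_affine (row_form u))%:C%C = dotmx u u.
Proof.
rewrite sqnorm_affine_cons rmorphD/= sqn_conj_pair /sqnorm_affine rmorph_sum/=.
rewrite dotmxE mxE big_split_ord big_ord1 !mxE normCK; congr (_ + _)%R.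
apply: eq_bigr => j _; rewrite !mxE -normCK -sqn_conj_pair.
by rewrite tnth_mktuple.
Qed.

Lemma linear_form_row_form (u : 'rV[R[i]]_(1 + d)) (w : d.-tuple C2) :
  linear_form (row_form u) (affine_one w) =
  conj_pair (dotmx u (affine_lift (affine_coord w))).
Proof.
have ReD : {morph @complex.Re R : x y / (x + y)%R} by move=> [? ?] [? ?].
have ImD : {morph @complex.Im R : x y / (x + y)%R} by move=> [? ?] [? ?].
rewrite linear_form_cons dotmx_affine_lift /conj_pair ReD ImD.
rewrite (big_morph _ ReD (erefl _)) (big_morph _ ImD (erefl _)) /cadd /cmul/=.
rewrite !mulr1 !mulr0 subr0 add0r opprD; congr (_ + _, _ + _)%R.
  apply: eq_bigr => j _; rewrite tnth_mktuple !mxE/=.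
  by case: (u _ _) => x y /=; ring.
rewrite -sumrN; apply: eq_bigr => j _; rewrite tnth_mktuple !mxE/=.
by case: (u _ _) => x y /=; ring.
Qed.

Lemma overlap_chart p (w : d.-tuple C2) :
  overlap p (chart w) =
  (sqn (linear_form (row_form (unitv (vpick p))) (affine_one w)) /
    (1 + sqnorm_affine w))%R.
Proof.
rewrite /overlap /chart; set v := affine_lift _.
have [c c0 ->] := vpick_proj (affine_lift_neq0 (affine_coord w)).
rewrite -[X in coherence X _]scale1r coherenceZ ?oner_neq0//.
rewrite linear_form_row_form -/v /coherence.
set D := dotmx _ (unitv v).
have DE : ((complex.Re `|D|)%:C%C = `|D|)%R by rewrite RRe_real ?normr_real.
apply: complexI; rewrite rmorphXn/= DE norm_dotmx_unitvr_sqr.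
by rewrite rmorphM/= sqn_conj_pair fmorphV/= -dotmx_affine_lift2.
Qed.

Lemma sqnorm_unit_row_form p : sqnorm_affine (row_form (unitv (vpick p))) = 1%R.
Proof.
by apply: complexI; rewrite sqnorm_row_form dotmx_unitv ?vpick_neq0.
Qed.

Lemma overlap_itv p q : (0 <= overlap p q <= 1)%R.
Proof.
have /andP[c0 c1] := coherence_itv (vpick_neq0 p) (vpick_neq0 q).
by rewrite sqr_ge0 exprn_ile1.
Qed.

Lemma cos_fs_dist_vpick p q : cos (fs_dist p q) = coherence (vpick p) (vpick q).
Proof.
have /andP[c0 c1] := coherence_itv (vpick_neq0 p) (vpick_neq0 q).
by rewrite /fs_dist acosK// in_itv/= c1 andbT (le_trans _ c0)// oppr_le0.
Qed.

Lemma overlapE p q : overlap p q = (cos (fs_dist p q) ^+ 2)%R.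
Proof. by rewrite /overlap cos_fs_dist_vpick. Qed.

Lemma measurable_fs_dist p : measurable_fun setT (fs_dist p).
Proof.
apply: (measurability (@RGenInftyO.G R)) => [|_ [_ [r ->] <-]].
  exact: RGenInftyO.measurableE.
rewrite setTI; apply: sub_sigma_algebra; exists p, r.
by apply/seteqP; split => q /=; rewrite in_itv.
Qed.

Lemma measurable_overlap p : measurable_fun setT (overlap p).
Proof.
rewrite (_ : overlap p = fun q => (cos (fs_dist p q) ^+ 2)%R); last first.
  by apply/funext => q; exact: overlapE.
apply: measurable_funX; apply: (measurableT_comp _ (measurable_fs_dist p)).
exact: continuous_measurable_fun (@continuous_cos R).
Qed.

End projective.

(** * The normalized volume and the beta law of the overlap *)

Section volume_law.
Variable n : nat.
Local Notation d := n.+1.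
Local Notation CP := (projective_space R d).
Implicit Types (p : CP).

Lemma riemannian_volume_overlap p (A : set R) : measurable A ->
  @riemannian_volume R d (overlap p @^-1` A) =
  (radial_constant R n)%:E * \int[mu]_(t in A) ((@XMonemX R 0 n) \_ `[0, 1] t)%R%:E.
Proof.
move=> mA; rewrite /riemannian_volume integral_mkcond.
pose h (t : R) : \bar R := (\1_A t)%:E.
have mh : measurable_fun setT h by apply/measurable_EFinP; exact: measurable_indic.
have h0 t : 0 <= h t by rewrite lee_fin.
pose a := row_form (unitv (vpick p)).
transitivity (\int[aff d]_w
    (h (sqn (linear_form a (affine_one w)) / (1 + sqnorm_affine w))%R
     * ((1 + sqnorm_affine w) ^- d.+1)%:E)).
  apply: eq_integral => w _; rewrite patchE /h indicE.
  rewrite -overlap_chart -fs_densityE -EFinM.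
  case: ifPn => wA.
    by rewrite (_ : _ \in A) ?mul1r// inE; move: wA; rewrite inE.
  by rewrite (_ : _ \in A = false) ?mul0r//; apply/negbTE; apply: contra wA; rewrite !inE.
rewrite affine_line_law// ?sqnorm_unit_row_form//; congr (_ * _).
rewrite [LHS]integral_mkcond [RHS]integral_mkcond; apply: eq_integral => t _.
rewrite !patchE /h indicE; case: (t \in A); case: (t \in `[0, 1]%classic%R);
by rewrite ?mule1 ?mule0.
Qed.

(** The law of the overlap with any one point gives the total mass. It is finite and nonzero, so
    [mnormalize] divides by it. *)
Lemma riemannian_volumeT :
  @riemannian_volume R d setT = (radial_constant R n * beta_fun 1 d)%:E.
Proof.
rewrite -(preimage_setT (overlap (point : CP))) riemannian_volume_overlap//.
by rewrite (EFinM (radial_constant R n)) EFin_beta_fun.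
Qed.

Lemma mnormalizeE e (T : measurableType e) (m : {measure set T -> \bar R})
    (P : probability T R) (c : R) (A : set T) : (c != 0)%R -> m setT = c%:E ->
  mnormalize m P A = m A * c^-1%:E.
Proof. by move=> c0 mT; rewrite /mnormalize mT eqe (negbTE c0). Qed.

Lemma fs_volume_overlap p (A : set R) : measurable A ->
  fs_volume R d (overlap p @^-1` A) = beta_prob 1 d A.
Proof.
move=> mA.
have c0 := radial_constant_gt0 R n.
have b0 : (0 < @beta_fun R 1 d)%R by exact: beta_fun_gt0.
have cb : (radial_constant R n * beta_fun 1 d)%R != 0%R by rewrite gt_eqF// mulr_gt0.
rewrite [LHS](mnormalizeE _ _ cb riemannian_volumeT).
rewrite [X in X * _](riemannian_volume_overlap p mA).
have -> : beta_prob 1 d A =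
    (@beta_fun R 1 d)^-1%:E *
      \int[mu]_(t in A) ((@XMonemX R 0 n) \_ `[0, 1] t)%R%:E by [].
rewrite muleAC -EFinM; congr (_%:E * _).
by field; rewrite !gt_eqF.
Qed.

Lemma ge0_integral_overlap p (h : R -> \bar R) :
  measurable_fun setT h -> (forall t, 0 <= h t) ->
  \int[fs_volume R d]_q h (overlap p q) = \int[beta_prob 1 d]_t h t.
Proof.
move=> mh h0.
pose m : {measure set Rp -> \bar R} :=
  pushforward (fs_volume R d) (overlap p : CP -> Rp).
rewrite (eq_measure_integral (m (measurable_overlap p))).
  by rewrite ge0_integral_pushforward//; exact: measurable_overlap.
by move=> A mA _; exact: esym (fs_volume_overlap p mA).
Qed.

End volume_law.
End overlap.

(** * Balls and overlaps *)

Section dot_triangle.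
Context (C : numClosedFieldType) (n : nat).
Implicit Types (x y z u v : 'rV[C]_n).

Lemma dotmx_conj u v : dotmx u v = (dotmx v u)^*.
Proof.
rewrite !dotmxE !mxE rmorph_sum/=; apply: eq_bigr => j _.
by rewrite !mxE rmorphM/= conjCK mulrC.
Qed.

Lemma norm_dotmxC u v : `|dotmx u v| = `|dotmx v u|.
Proof. by rewrite dotmx_conj norm_conjC. Qed.

(** Split z into its projection <z,y> y on y and a remainder. The first part contributes at most
    |<x,y>| since |<z,y>| <= 1; the remainder has norm e, and Cauchy-Schwarz bounds its
    contribution. The moduli are variables with equations so that real coherences can be substituted
    for them. *)
Lemma norm_dotmx_triangle x y z (a b c e : C) :
  a = `|dotmx x z| -> b = `|dotmx x y| -> c = `|dotmx y z| ->
  dotmx x x = 1 -> dotmx y y = 1 -> dotmx z z = 1 -> 0 <= e ->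
  e ^+ 2 = 1 - c ^+ 2 -> a <= b + e.
Proof.
move=> -> -> -> x1 y1 z1 e0 e2 {a b c}; set a := dotmx z y.
have -> : dotmx x z = a^* * dotmx x y + dotmx x (z - a *: y).
  by rewrite linearBr/= linearZr_LR/= addrC subrK.
apply: (le_trans (ler_normD _ _)); apply: lerD.
  rewrite normrM norm_conjC ler_piMl//.
  rewrite -(@expr_le1 _ 2)// -subr_ge0 /a norm_dotmxC -e2.
  by rewrite exprn_ge0.
rewrite -(@ler_pXn2r _ 2)// ?nnegrE//.
apply: le_trans (_ : _ <= dotmx x x * dotmx (z - a *: y) (z - a *: y)) _.
  exact: (CauchySchwarz _ _ _).1.
have -> : dotmx (z - a *: y) (z - a *: y) =
    dotmx z z - a^* * dotmx z y - a * (dotmx y z - a^* * dotmx y y).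
  by rewrite linearBl linearZl_LR/= !linearBr !linearZr_LR.
rewrite x1 y1 z1 (dotmx_conj y z) -/a mulr1 subrr mulr0 subr0 mul1r.
by rewrite mulrC -normCK /a norm_dotmxC e2.
Qed.

End dot_triangle.

Section geometry.
Context (R : realType) (d : nat).
Local Notation CP := (projective_space R d).
Implicit Types (p q : CP).

Lemma coherenceE n (u v : 'rV[R[i]]_n) :
  (coherence u v)%:C%C = `|dotmx (unitv u) (unitv v)|.
Proof. by rewrite /coherence RRe_real ?normr_real. Qed.

Lemma coherenceC n (u v : 'rV[R[i]]_n) : coherence u v = coherence v u.
Proof. by rewrite /coherence [in LHS](norm_dotmxC (unitv u) (unitv v)). Qed.

Lemma coherence_triangle n (x y z : 'rV[R[i]]_n) : x != 0 -> y != 0 -> z != 0 ->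
  coherence x z <= coherence x y + Num.sqrt (1 - coherence y z ^+ 2).
Proof.
move=> x0 y0 z0.
have /andP[c0 c1] := coherence_itv y0 z0.
have c2 : 0 <= 1 - coherence y z ^+ 2 by rewrite subr_ge0 exprn_ile1.
rewrite -lecR rmorphD/=.
apply: (norm_dotmx_triangle (coherenceE x z) (coherenceE x y) (coherenceE y z)
  (dotmx_unitv x0) (dotmx_unitv y0) (dotmx_unitv z0)).
  by rewrite lecR sqrtr_ge0.
by rewrite -!rmorphXn/= sqr_sqrtr// rmorphB rmorph1.
Qed.

(** Coherences vary by at most sqrt (1 - t); in a^2 - b^2 = (a - b)(a + b) the second factor is at
    most 2. *)
Lemma overlap_lipschitz p x y :
  overlap p x - overlap p y <= 2 * Num.sqrt (1 - overlap x y).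
Proof.
have real (a b e : R) : 0 <= a <= 1 -> 0 <= b <= 1 -> 0 <= e -> a <= b + e ->
    a ^+ 2 - b ^+ 2 <= 2 * e.
  by move=> /andP[a0 a1] /andP[b0 b1] e0 abe; have [ab|ab] := leP a b; nra.
have := coherence_triangle (vpick_neq0 p) (vpick_neq0 y) (vpick_neq0 x).
rewrite (coherenceC (vpick y)).
exact: real (coherence_itv (vpick_neq0 p) (vpick_neq0 x))
  (coherence_itv (vpick_neq0 p) (vpick_neq0 y)) (sqrtr_ge0 _).
Qed.

Lemma metric_ball_overlap (A : set CP) : metric_ball A ->
  measurable A /\ exists p (a : R),
    (forall x, A x -> a <= overlap p x) /\ (forall y, ~ A y -> overlap p y <= a).
Proof.
move=> [p [r [r0 Ar]]]; have mA : measurable A.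
  case: Ar => ->.
    by apply: sub_sigma_algebra; exists p, r.
  rewrite (_ : [set q | _] = fs_dist p @^-1` `]-oo, r]); last first.
    by apply/seteqP; split => q /=; rewrite in_itv.
  by rewrite -[X in measurable X]setTI; apply: measurable_fs_dist.
split => //; exists p.
have sqr_le (a b : R) : 0 <= a -> a <= b -> a ^+ 2 <= b ^+ 2.
  by move=> a0 ab; rewrite lerXn2r// nnegrE// (le_trans a0).
have mono x y : A x -> ~ A y -> overlap p y <= overlap p x.
  move=> Ax Ay.
  have xy : fs_dist p x <= fs_dist p y.
    case: Ar Ax Ay => -> /= px /negP; rewrite -?leNgt -?ltNge => py.
      exact/ltW/(lt_le_trans px).
    exact/ltW/(le_lt_trans px).
  have dist_itv q : fs_dist p q \in `[0, pi].
    have /andP[c0 c1] := coherence_itv (vpick_neq0 p) (vpick_neq0 q).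
    have c : -1 <= coherence (vpick p) (vpick q) <= 1.
      by rewrite c1 andbT (le_trans _ c0)// oppr_le0.
    by rewrite in_itv/= /fs_dist acos_ge0 ?acos_lepi.
  have /andP[cx0 _] := coherence_itv (vpick_neq0 p) (vpick_neq0 x).
  have /andP[cy0 _] := coherence_itv (vpick_neq0 p) (vpick_neq0 y).
  have cc : coherence (vpick p) (vpick y) <= coherence (vpick p) (vpick x).
    by rewrite -(cos_fs_dist_vpick p y) -(cos_fs_dist_vpick p x) leNgt ltr_cos// -leNgt.
  exact: sqr_le cy0 cc.
(* The threshold is a supremum off the ball because cos(r)^2 would be wrong for radii beyond pi/2;
   it also treats open and closed balls alike. If the ball is the whole space, the supremum of the
   empty set is 0, a lower bound for overlaps. *)
exists (sup [set overlap p y | y in ~` A]); split => [x Ax|y Ay].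
  have [E|/set0P ne] := eqVneq [set overlap p y | y in ~` A] set0.
    by rewrite E sup0; have /andP[] := overlap_itv p x.
  by apply: ge_sup => // _ [y /= Ay <-]; exact: mono.
apply: ub_le_sup; last by exists y.
by exists 1 => _ [z _ <-]; have /andP[] := overlap_itv p z.
Qed.
End geometry.

(** * The variance of a determinantal counting function *)

Section tuple_integrals.
Context d (T : measurableType d) (R : realType).
Variable mu : {sigma_finite_measure set T -> \bar R}.
Local Open Scope ereal_scope.

Lemma ge0_integral_measure_power1 (f : 1.-tuple T -> \bar R) :
  measurable_fun setT f -> (forall y, 0 <= f y) ->
  \int[measure_power mu 1]_y f y = \int[mu]_x f [tuple x].
Proof.
move=> mf f0; rewrite (ge0_integral_measure_power_step mu (measure_power mu 0) mf f0).
apply: eq_integral => x _; rewrite integral_dirac//.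
  by rewrite diracT mul1e; congr f; exact: val_inj.
by apply: (measurableT_comp mf); exact: measurable_cons.
Qed.

Lemma ge0_integral_measure_power2 (f : 2.-tuple T -> \bar R) :
  measurable_fun setT f -> (forall y, 0 <= f y) ->
  \int[measure_power mu 2]_y f y = \int[mu]_x \int[mu]_y f [tuple x; y].
Proof.
move=> mf f0; rewrite (ge0_integral_measure_power_step mu (measure_power mu 1) mf f0).
apply: eq_integral => x _; rewrite ge0_integral_measure_power1//.
by apply: (measurableT_comp mf); exact: measurable_cons.
Qed.

Lemma measurable_pair_tuple : measurable_fun setT (fun p : T * T => [tuple p.1; p.2]).
Proof. by apply: measurable_cons => //; exact: measurable_cons. Qed.

End tuple_integrals.

Section count.
Context dO (Omega : measurableType dO) (R : realType) (P : probability Omega R).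
Context dT (T : measurableType dT).
Variable X : Omega -> {fset T}.

Lemma num_pointsC A w :
  (num_points X A w + num_points X (~` A) w)%N = #|` X w|.
Proof.
rewrite /num_points -cardfsUI [X in (_ + #|` X|)%N](_ : _ = fset0); last first.
  apply/fsetP => x; rewrite !inE/=; apply/negP => /andP[/andP[_ xA] /andP[_ xNA]].
  by move: xA xNA; rewrite !inE.
rewrite cardfs0 addn0; congr #|` _|; apply/fsetP => x; rewrite !inE/=.
by case: (x \in X w) => //=; rewrite -in_setU setUv in_setT.
Qed.

Lemma num_points_le A w : (num_points X A w <= #|` X w|)%N.
Proof. by rewrite -(num_pointsC A w) leq_addr. Qed.

End count.

Lemma bounded_Lfun1 dO (Omega : measurableType dO) (R : realType)
    (P : probability Omega R) (f : Omega -> R) (M : R) :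
  measurable_fun setT f -> (forall w, `|f w| <= M) -> f \in Lfun P 1%E.
Proof.
move=> mf fM; rewrite inE; apply/Lfun1_integrable.
apply: measurable_bounded_integrable => //.
  by rewrite -ge0_fin_numE// fin_num_measure.
exists M; split; first by rewrite num_real.
by move=> x Mx w _ /=; rewrite (le_trans (fM w))// ltW.
Qed.

(* The conclusion only involves joint moments of the numbers of points in a set and in its
   complement, which joint intensities determine. *)
Lemma variance_complement dO (Omega : measurableType dO) (R : realType)
    (P : probability Omega R) (Y : Omega -> R) (N : R) :
  measurable_fun setT Y -> (forall w, 0 <= Y w <= N) ->
  ('V_P[Y] = 'E_P[Y] * (N%:E - 'E_P[Y]) - 'E_P[fun w => (Y w * (N - Y w))%R])%E.
Proof.
move=> mY Y0N.
have L1Y : Y \in Lfun P 1%E.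
  apply: (@bounded_Lfun1 _ _ _ _ _ N) => // w.
  by have /andP[Y0 YN] := Y0N w; rewrite ger0_norm.
have L1YY : (Y * Y)%R \in Lfun P 1%E.
  apply: (@bounded_Lfun1 _ _ _ _ _ (N * N)) => [|w]; first exact: measurable_funM.
  have /andP[Y0 YN] := Y0N w.
  by rewrite ger0_norm ?mulr_ge0// ler_pM.
rewrite /variance covarianceE//.
have -> : (fun w => Y w * (N - Y w)) = ((N \o* Y) \- (Y * Y)).
  by apply/funext => w /=; rewrite mulrBr.
rewrite expectationB//; last by rewrite Lfun_scale.
rewrite expectationZl//.
have /fineK <- := expectation_fin_num L1Y.
have /fineK <- := expectation_fin_num L1YY.
by rewrite -EFinM -!EFinB; congr EFin; ring.
Qed.

Lemma det_mx22 (C : comNzRingType) (M : 'M[C]_2) :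
  \det M = M 0 0 * M 1 1 - M 0 1 * M 1 0.
Proof.
rewrite (expand_det_row _ 0) !big_ord_recl big_ord0 addr0 /cofactor !det_mx11 !mxE.
rewrite expr0 expr1 mul1r mulN1r mulrN.
by congr (_ * M _ _ - M _ _ * M _ _); apply: val_inj.
Qed.

Section determinantal_variance.
Context dO (Omega : measurableType dO) (R : realType) (P : probability Omega R).
Context dT (T : measurableType dT) (mu : probability T R).
Variables (X : Omega -> {fset T}) (N : nat) (K : T -> T -> R[i]) (k2 : T -> T -> R).
Hypothesis X_simple : simple_point_process N X.
Hypothesis X_det : determinantal P mu X K.
Hypothesis K_diag : forall x, K x x = N%:R.
Hypothesis K_sqr : forall x y, K x y * K y x = (k2 x y)%:C%C.
Hypothesis k2_itv : forall x y, 0 <= k2 x y <= N%:R ^+ 2.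
Local Open Scope ereal_scope.

Lemma expectation_num_points A : measurable A ->
  'E_P[fun w => (num_points X A w)%:R] = N%:R%:E * mu A.
Proof.
move=> mA; have [rho [[mrho +] rhoE]] := X_det (ltn0Sn 0).
move=> /(_ (fun=> A) (fun=> mA)).
have rhoN y : rho y = N%:R.
  by apply: complexI; rewrite rhoE det_mx11 mxE K_diag rmorph_nat.
have t1 : trivIset [set: 'I_1] (fun=> A).
  by apply/trivIsetP => i j _ _; rewrite !ord1 eqxx.
move=> /(_ t1) E.
transitivity ('E_P[fun w => \prod_(i < 1) (num_points X A w)%:R]%R).
  by congr expectation; apply/funext => w; rewrite big_ord1.
rewrite E integral_mkcond.
transitivity (\int[measure_power mu 1]_y (N%:R * \1_A (tnth y ord0))%:E).
  apply: eq_integral => y _; rewrite patchE rhoN indicE.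
  have -> : (y \in [set y | forall i : 'I_1, A (tnth y i)]) = (tnth y ord0 \in A).
    apply/idP/idP; rewrite !inE => Ay; first exact: Ay.
    by move=> i; rewrite ord1.
  by case: ifP => _; rewrite ?mulr1 ?mulr0.
rewrite ge0_integral_measure_power1; last 2 first.
- apply/measurable_EFinP; apply: measurable_funM => //.
  by apply: (measurableT_comp (measurable_indic mA)); exact: measurable_tnth.
- by move=> y; rewrite lee_fin mulr_ge0.
under eq_integral do rewrite EFinM.
rewrite ge0_integralZl//; last exact/measurable_EFinP/measurable_indic.
congr (_ * _); transitivity (mu (A `&` setT)); first exact: integral_indic.
by rewrite setIT.
Qed.

Let rho2 : exists2 rho : 2.-tuple T -> R, joint_intensity P mu X rho &
  forall y, rho y = (N%:R ^+ 2 - k2 (tnth y 0%R) (tnth y 1%R))%R.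
Proof.
have [rho [Jrho rhoE]] := X_det (ltn0Sn 1); exists rho => // y.
apply: complexI; rewrite rhoE det_mx22 !mxE !K_diag K_sqr.
by rewrite rmorphB rmorphXn/= rmorph_nat.
Qed.

(** Joint measurability is inherited from the second joint intensity, whose measurability is part of
    its definition. *)
Lemma measurable_k2 :
  measurable_fun setT (fun y : 2.-tuple T => k2 (tnth y 0%R) (tnth y 1%R)).
Proof.
have [rho [mrho _] rhoE] := rho2.
rewrite (_ : (fun y => _) = fun y => (N%:R ^+ 2 - rho y)%R); last first.
  by apply/funext => y; rewrite rhoE opprB addrC subrK.
exact: measurable_funB.
Qed.

Lemma variance_num_points A : measurable A ->
  'V_P[fun w => (num_points X A w)%:R] =
  \int[mu]_x \int[mu]_y (\1_A x * \1_(~` A) y * k2 x y)%:E.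
Proof.
move=> mA; have mC := measurableC mA; have [XN mX] := X_simple.
have mY : measurable_fun setT (fun w => (num_points X A w)%:R : R).
  have mR : measurable_fun setT (fun n : nat => n%:R : R) by [].
  exact: (measurableT_comp mR (mX A mA)).
rewrite (@variance_complement _ _ _ _ _ N%:R)//; last first.
  by move=> w; rewrite ler0n ler_nat -(XN w) num_points_le.
rewrite expectation_num_points//.
have [rho [mrho Jrho] rhoE] := rho2.
pose s (y : 2.-tuple T) : R := (\1_A (tnth y 0%R) * \1_(~` A) (tnth y 1%R))%R.
have s0 y : (0 <= s y)%R by rewrite mulr_ge0.
have ms : measurable_fun setT s.
  apply: measurable_funM.
    by apply: (measurableT_comp (measurable_indic mA)); exact: measurable_tnth.
  by apply: (measurableT_comp (measurable_indic mC)); exact: measurable_tnth.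
have rho_ge0 y : (0 <= rho y)%R.
  by rewrite rhoE subr_ge0; have /andP[] := k2_itv (tnth y 0%R) (tnth y 1%R).
have k2_ge0 x y : (0 <= k2 x y)%R by have /andP[] := k2_itv x y.
have Erho : 'E_P[fun w => ((num_points X A w)%:R * (N%:R - (num_points X A w)%:R))%R] =
    \int[measure_power mu 2]_y (s y * rho y)%:E.
  pose B (i : 'I_2) := if i == 0%R then A else ~` A.
  have mB i : measurable (B i) by rewrite /B; case: ifP.
  have tB : trivIset setT B.
    apply/trivIsetP => i j _ _ ij; rewrite /B.
    case: (altP (i =P 0%R)) ij => [->|i0]; case: (altP (j =P 0%R)) => [->//|j0] ij.
    - by rewrite setICr.
    - by rewrite setICl.
    - by case/eqP: ij; apply: val_inj; case: i j i0 j0 => [[|[|?]] ?] [[|[|?]] ?].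
  transitivity ('E_P[fun w => \prod_(i < 2) (num_points X (B i) w)%:R]%R).
    congr expectation; apply/funext => w.
    rewrite !big_ord_recl big_ord0 mulr1 /B/=; congr (_ * _)%R.
    by rewrite -(XN w) -(num_pointsC X A w) natrD addrC addKr.
  rewrite (Jrho _ mB tB) integral_mkcond; apply: eq_integral => y _.
  rewrite patchE /s !indicE.
  have -> : (y \in [set y | forall i, B i (tnth y i)]) =
      (tnth y 0%R \in A) && (tnth y 1%R \in ~` A).
    apply/idP/andP => [/set_mem By|[/set_mem A0 /set_mem A1]].
      by split; apply/mem_set; [exact: (By 0%R)|exact: (By 1%R)].
    apply/mem_set => i; rewrite /B; case: (altP (i =P 0%R)) => [->//|i0].
    by rewrite (_ : i = 1%R)//; apply: val_inj; case: i i0 => [[|[|?]] ?].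
  by case: (tnth y 0%R \in A); case: (tnth y 1%R \in ~` A);
    rewrite /= ?mulr1 ?mulr0 ?mul0r ?mul1r.
rewrite Erho.
(* Since [rho] + [k2] is the constant N^2, the two integrals add up to N^2 times the volumes of A
   and of its complement. The identity is a sum because subtraction of extended reals needs
   finiteness, established next. *)
have EI : \int[measure_power mu 2]_y (s y * rho y)%:E +
    \int[measure_power mu 2]_y (s y * k2 (tnth y 0%R) (tnth y 1%R))%:E =
    N%:R%:E * mu A * (N%:R%:E - N%:R%:E * mu A).
  rewrite -ge0_integralD//; last 4 first.
  - by move=> y _; rewrite lee_fin mulr_ge0.
  - by apply/measurable_EFinP; exact: measurable_funM.
  - by move=> y _; rewrite lee_fin mulr_ge0.
  - by apply/measurable_EFinP; apply: measurable_funM => //; exact: measurable_k2.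
  transitivity (\int[measure_power mu 2]_y (N%:R ^+ 2 * s y)%:E).
    by apply: eq_integral => y _; rewrite rhoE -EFinD; congr EFin; ring.
  rewrite ge0_integral_measure_power2; last 2 first.
  - by apply/measurable_EFinP; exact: measurable_funM.
  - by move=> y; rewrite lee_fin mulr_ge0// sqr_ge0.
  transitivity (\int[mu]_x ((N%:R ^+ 2 * \1_A x)%:E * \int[mu]_y (\1_(~` A) y)%:E)).
    apply: eq_integral => x _.
    rewrite -ge0_integralZl//; last exact/measurable_EFinP/measurable_indic.
    by apply: eq_integral => y _; rewrite -EFinM; congr EFin; exact: mulrA.
  rewrite ge0_integralZr//; last 2 first.
  - by apply/measurable_EFinP; apply: measurable_funM => //; exact: measurable_indic.
  - by apply: integral_ge0 => y _; rewrite lee_fin.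
  under eq_integral do rewrite EFinM.
  rewrite ge0_integralZl//; last exact/measurable_EFinP/measurable_indic.
  rewrite !integral_indic// !setIT.
  have Ea : mu A = (fine (mu A))%:E by rewrite fineK// fin_num_measure.
  have Eb : mu (~` A) = (1 - fine (mu A))%:E by rewrite probability_setC// EFinB -Ea.
  transitivity ((N%:R ^+ 2)%:E * (fine (mu A))%:E * (1 - fine (mu A))%:E).
    by congr (_ * _ * _); [exact: Ea|exact: Eb].
  move: Ea; set a := fine _ => ->.
  rewrite -[N%:R%:E * a%:E]EFinM -[N%:R%:E - _]EFinB -!EFinM; congr EFin; ring.
have I1fin : \int[measure_power mu 2]_y (s y * rho y)%:E \is a fin_num.
  have := fin_num_measure mu A mA => Afin.
  have NA : N%:R%:E * mu A \is a fin_num by rewrite fin_numM.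
  have : N%:R%:E * mu A * (N%:R%:E - N%:R%:E * mu A) \is a fin_num.
    by rewrite fin_numM// fin_numB NA.
  by rewrite -EI fin_numD => /andP[].
rewrite -EI addeAC subee// add0e ge0_integral_measure_power2//.
- by apply/measurable_EFinP; apply: measurable_funM => //; exact: measurable_k2.
- by move=> y; rewrite lee_fin mulr_ge0.
Qed.

End determinantal_variance.

(** * The boundary integral *)

Section beta_bounds.
Context (R : realType) (n : nat).
Local Notation Rp := (measurableTypeR R).
Local Notation mu := (@lebesgue_measure R).
Local Notation beta := (@beta_prob R 1 n.+1).
Local Open Scope ereal_scope.

(** The density of Beta(1, n+1) is at most the inverse of its normalizing constant, which is n +
    1. *)
Lemma beta_prob_itv_le (a b : R) : (a <= b)%R ->
  beta `[a, b]%classic <= (n.+1%:R * (b - a))%:E.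
Proof.
move=> ab; have mab : measurable (`[a, b]%classic : set Rp) by exact: measurable_itv.
rewrite -integral_beta_pdf//.
apply: (@le_trans _ _ (\int[mu]_(x in `[a, b]) (n.+1%:R)%:E)).
  apply: ge0_le_integral => //.
  - by move=> x _; rewrite lee_fin beta_pdf_ge0.
  - by apply/measurable_EFinP; apply/measurable_funTS; exact: measurable_beta_pdf.
  - move=> x _; rewrite lee_fin (le_trans (beta_pdf_le_beta_funV _ _ _))//.
    by rewrite beta_fun1Sn invrK.
rewrite integral_cst// [X in _ * X](_ : _ = (b - a)%:E) -?EFinM//.
rewrite [LHS]lebesgue_measure_itv/= lte_fin; case: ltP => [_|ba]; first by rewrite -EFinB.
by rewrite (_ : b = a) ?subrr//; apply/eqP; rewrite eq_le ba.
Qed.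

(** The integrand t^L (1 - t)^k, cut off so as to be nonnegative on the whole line; overlaps lie in
    [0, 1] and do not see the cutoff. *)
Definition beta_moment L k (t : R) : R := ((@XMonemX R L k) \_ `[0, 1])%R t.

Lemma beta_moment_ge0 L k t : (0 <= beta_moment L k t)%R.
Proof.
by rewrite /beta_moment patchE; case: ifPn => // /set_mem t01; exact: XMonemX_ge0.
Qed.

Lemma measurable_beta_moment L k :
  measurable_fun setT (beta_moment L k : Rp -> R).
Proof.
by apply/measurable_restrict => //=; rewrite setTI; exact: measurable_XMonemX.
Qed.

(** Multiplying by the density proportional to (1 - t)^n raises the exponent of 1 - t to n + k and
    leaves another beta integral. *)
Lemma integral_beta_moment L k :
  \int[beta]_t (beta_moment L k t)%:E =
  (beta_fun L.+1 (n + k).+1 / beta_fun 1 n.+1)%:E.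
Proof.
have mI : measurable (`[0%R, 1%R]%classic : set Rp) by exact: measurable_itv.
transitivity (\int[beta]_(t in `[0%R, 1%R]) (@XMonemX R L k t)%:E).
  rewrite [RHS]integral_mkcond; apply: eq_integral => t _.
  by rewrite /beta_moment !patchE; case: ifP.
rewrite integral_beta_prob//; last 2 first.
- by apply/measurable_EFinP; exact: measurable_XMonemX.
- by have /integrableP[] := @beta_prob_integrable R 1 n.+1 L k.
rewrite mulrC EFinM EFin_beta_fun -ge0_integralZl//; last 3 first.
- by apply/measurable_EFinP; exact: measurable_beta_moment.
- by move=> t _; rewrite lee_fin beta_moment_ge0.
- by rewrite lee_fin invr_ge0 beta_fun_ge0.
rewrite [LHS]integral_mkcond; apply: eq_integral => t _.
rewrite !patchE /beta_pdf patchE; case: ifPn => t01; last by rewrite mule0.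
rewrite -!EFinM; congr EFin; rewrite mulrA mulrC; congr (_ * _)%R.
by rewrite t01 XMonemXM add0n.
Qed.

End beta_bounds.

(** * Binomial estimates and explicit beta moments *)

Section numeric_bounds.

(** By induction from (d+1) C(d+1+L, d+1) = (d+1+L) C(d+L, d), since d + 1 + L <= 2 L (d+1) for L >=
    1. *)
Lemma binomial_le (d L : nat) : (1 <= L)%N -> ('C(d + L, d) <= (2 * L) ^ d)%N.
Proof.
move=> L1; elim: d => [|d IH]; first by rewrite bin0.
rewrite -(leq_pmul2l (ltn0Sn d)) -mul_bin_diag addSn /= expnS mulnCA.
rewrite [leqRHS]mulnCA mulnA; apply: leq_mul => //.
rewrite mulSn -addnS addnC leq_add//; last by rewrite leq_pmulr// muln_gt0.
by rewrite mul2n -addnn -addn1 leq_add2l.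
Qed.

(** Equivalent to N^(1/(2d)) <= 2 sqrt L. The bound N <= (2L)^d gives sqrt 2 sqrt L, and sqrt 2 is
    rounded up to 2. *)
Lemma powR_binomial_ge (R : realType) (d L : nat) : (1 <= d)%N -> (1 <= L)%N ->
  'C(d + L, d)%:R / Num.sqrt L%:R <=
    2 * 'C(d + L, d)%:R `^ (1 - (2 * d)%:R^-1) :> R.
Proof.
move=> d1 L1; set N := 'C(_, _).
have N0 : (0 < N%:R :> R) by rewrite ltr0n bin_gt0 leq_addr.
have L0 : (0 < L%:R :> R) by rewrite ltr0n.
have s0 : 0 < Num.sqrt L%:R :> R by rewrite sqrtr_gt0.
rewrite powRD; last by apply/implyP => _; rewrite gt_eqF.
rewrite powRr1 ?ler0n// powRN [2 * _]mulrCA ler_pM2l//.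
have Nd0 : 0 < (N%:R : R) `^ (2 * d)%:R^-1 by rewrite powR_gt0.
rewrite -[leLHS]mul1r ler_pdivrMr// mulrAC ler_pdivlMr// mul1r.
apply: (@le_trans _ _ (((2 * L) ^ d)%:R `^ (2 * d)%:R^-1)).
  by apply: ge0_ler_powR; rewrite ?nnegrE ?invr_ge0 ?ler_nat ?binomial_le.
rewrite natrX -powR_mulrn// -powRrM.
have -> : d%:R * (2 * d)%:R^-1 = 2^-1 :> R.
  by rewrite natrM; field; rewrite pnatr_eq0 -lt0n.
rewrite powR12_sqrt// natrM sqrtrM// ler_pM2r//.
rewrite -[leRHS]ger0_norm// -sqrtr_sqr ler_sqrt ?sqr_ge0//.
by rewrite -natrX ler_nat.
Qed.

(** The difference of the two sides is a nonnegative multiple of (1 - s e)^2 with e = sqrt (1 - t).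
    The weight m will be t^L and s will be sqrt L. *)
Lemma shell_amgm (R : realType) (D s m t : R) : 0 <= D -> 0 < s -> 0 <= m -> t <= 1 ->
  m * (D * (2 * Num.sqrt (1 - t))) <= D / s * m + D * s * (m * (1 - t)).
Proof.
move=> D0 s0 m0 t1; set e := Num.sqrt _.
have <- : e ^+ 2 = 1 - t by rewrite sqr_sqrtr ?subr_ge0.
rewrite -subr_ge0.
have -> : D / s * m + D * s * (m * e ^+ 2) - m * (D * (2 * e)) =
    D * m / s * (1 - s * e) ^+ 2 by field; rewrite gt_eqF.
by rewrite mulr_ge0 ?sqr_ge0// divr_ge0 ?mulr_ge0// ltW.
Qed.

(** The L-th moment of the overlap is 1/N. This matches the reproducing property of a projection
    kernel: the integral over q of |K(p,q)|^2 is N^2 / N = K(p,p). *)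
Lemma beta_fun_binomial (R : realType) (n L : nat) :
  beta_fun L.+1 n.+1 / beta_fun 1 n.+1 = 'C(n.+1 + L, n.+1)%:R^-1 :> R.
Proof.
rewrite beta_fun1Sn beta_fun_fact invrK.
have f0 m : m`!%:R != 0 :> R by rewrite pnatr_eq0 -lt0n fact_gt0.
have b0 : 'C(n.+1 + L, n.+1)%:R != 0 :> R by rewrite pnatr_eq0 -lt0n bin_gt0 leq_addr.
have E : ('C(n.+1 + L, n.+1) * (n.+1`! * L`!))%N = (L + n).+1`!.
  by have := bin_fact (leq_addr L n.+1); rewrite addKn [(L + n)%N]addnC.
have fL := f0 L; have fn := f0 n; have n0 : n.+1%:R != 0 :> R by rewrite pnatr_eq0.
rewrite -E natrM factS !natrM -!mulrA; move: b0; set b := 'C(_, _)%:R => b0.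
move: (n.+1%:R : R) n0 => c c0; by field; rewrite b0 fL fn c0.
Qed.

(** The ratio is the mean of 1 - t under Beta(L+1, n+1), of order 1/L. *)
Lemma beta_fun_succ (R : realType) (n L : nat) :
  beta_fun L.+1 n.+2 = n.+1%:R / (L + n).+2%:R * beta_fun L.+1 n.+1 :> R.
Proof.
rewrite !beta_fun_fact addnS [n.+1`!]factS [(L + n).+2`!]factS mulnCA.
by rewrite (natrM R n.+1) (natrM R (L + n).+2) invfM mulrACA.
Qed.

End numeric_bounds.

(** * The integral over pairs separated by the boundary of a ball *)

Section boundary_integral.
Context (R : realType) (n : nat).
Local Notation d := n.+1.
Local Notation Rp := (measurableTypeR R).
Local Notation CP := (projective_space R d).
Local Notation vol := (fs_volume R d).
Local Notation beta := (@beta_prob R 1 d).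
Local Open Scope ereal_scope.

Lemma measurable_bool_natr e (T : measurableType e) (b : T -> bool) :
  measurable_fun setT b -> measurable_fun setT (fun x => (b x)%:R : R).
Proof.
move=> mb; have mR : measurable_fun setT (fun b : bool => b%:R : R) by [].
exact: (measurableT_comp mR mb).
Qed.

(* If x is in the ball and y is not, then x lies in a shell of width 2 sqrt (1 - t), where t is
   the overlap of x and y; since the law of the overlap has a density at most d, the volume of
   this shell is at most d times its width. *)
Lemma boundary_integral_shell (A : set CP) (p : CP) (a : R) (L : nat) :
  measurable A ->
  (forall x, A x -> a <= overlap p x)%R -> (forall y, ~ A y -> overlap p y <= a)%R ->
  measurable_fun setT (fun q : CP * CP => overlap q.1 q.2 ^+ L)%R ->
  \int[vol]_x \int[vol]_y (\1_A x * \1_(~` A) y * overlap x y ^+ L)%:E <=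
  \int[beta]_t (beta_moment L 0 t * (d%:R * (2 * Num.sqrt (1 - t))))%:E.
Proof.
move=> mA Aa aA mL; have mC := measurableC mA.
pose w (t : R) : R := (2 * Num.sqrt (1 - t))%R.
have mw : measurable_fun setT w.
  apply: measurable_funM => //.
  apply: (measurableT_comp (continuous_measurable_fun (@sqrt_continuous R))).
  exact: measurable_funB.
have w0 t : (0 <= w t)%R by rewrite mulr_ge0// sqrtr_ge0.
(* The coordinates stand for s = overlap of p with x and t = overlap of x with y; the first factor
   says that s lies in the shell. *)
pose g (q : Rp * Rp) : R :=
  (((a <= q.1) && (q.1 <= a + w q.2))%R%:R * beta_moment L 0 q.2)%R.
have mg : measurable_fun setT (fun q => (g q)%:E).
  apply/measurable_EFinP; apply: measurable_funM.
    apply: measurable_bool_natr; apply: measurable_and.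
      exact: measurable_fun_ler.
    apply: measurable_fun_ler => //; apply: measurable_funD => //.
    exact: (measurableT_comp mw).
  exact: (measurableT_comp (@measurable_beta_moment R L 0) measurable_snd).
have g0 q : 0 <= (g q)%:E by rewrite lee_fin mulr_ge0// beta_moment_ge0.
pose H (s : R) : \bar R := \int[beta]_t (g (s, t))%:E.
have mH : measurable_fun setT H.
  exact: (measurable_fun_fubini_tonelli_F (fun q => (g q)%:E)).
have H0 s : 0 <= H s by exact: integral_ge0.
have key (u v b e : R) : (u - v <= e -> v <= b -> u <= b + e)%R by lra.
have bmE x y : beta_moment L 0 (overlap x y) = (overlap x y ^+ L)%R.
  rewrite /beta_moment patchE mem_setE in_itv/= overlap_itv.
  by rewrite XMonemXn0.
(* At fixed x the bounding integrand depends on y only through its overlap with x, so the law of the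
   overlap turns the integral over y into one over t. *)
apply: (@le_trans _ _ (\int[vol]_x H (overlap p x))).
  have mgx x : measurable_fun setT (fun t : R => (g (overlap p x, t))%:E).
    by apply: (measurableT_comp mg); exact/measurable_fun_pair.
  pose f (q : CP * CP) := (\1_A q.1 * \1_(~` A) q.2 * overlap q.1 q.2 ^+ L)%:E : \bar R.
  have f0 q : 0 <= f q.
    by rewrite lee_fin !mulr_ge0// exprn_ge0//; have /andP[] := overlap_itv q.1 q.2.
  have mf : measurable_fun setT f.
    apply/measurable_EFinP; apply: measurable_funM => //; apply: measurable_funM.
      exact: (measurableT_comp (measurable_indic mA)).
    exact: (measurableT_comp (measurable_indic mC)).
  apply: ge0_le_integral => //.
  - by move=> x _; exact: (integral_ge0 _ (fun y _ => f0 (x, y))).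
  - exact: (measurable_fun_fubini_tonelli_F f).
  - by apply: (measurableT_comp mH); exact: measurable_overlap.
  move=> x _; rewrite /H -(ge0_integral_overlap x (mgx x))//.
  apply: ge0_le_integral; first exact: measurableT.
  - by move=> y _; exact: (f0 (x, y)).
  - have mx : measurable_fun setT (fun y : CP => (x, y)) by exact/measurable_fun_pair.
    exact: (measurableT_comp mf mx).
  - exact: (measurableT_comp (mgx x) (measurable_overlap x)).
  move=> y _; rewrite lee_fin /g /= bmE.
  have o0 : (0 <= overlap x y ^+ L)%R.
    by rewrite exprn_ge0//; have /andP[] := overlap_itv x y.
  rewrite !indicE.
  case: (boolP (x \in A)) => [/set_mem xA|_]; last by rewrite !mul0r mulr_ge0.
  case: (boolP (y \in ~` A)) => [/set_mem yA|_]; last first.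
    by rewrite mulr0 mul0r mulr_ge0.
  rewrite Aa// (_ : (overlap p x <= _)%R) ?mul1r//.
  exact: key (overlap_lipschitz p x y) (aA _ yA).
(* Now x occurs only through its overlap with p, and the same law is applied a second time.
   Exchanging the integrals leaves, at fixed t, the probability that s lies in an interval. *)
rewrite (ge0_integral_overlap p mH H0).
rewrite (fubini_tonelli (m1 := beta) (m2 := beta) (fun q => (g q)%:E))//.
apply: ge0_le_integral; first exact: measurableT.
- by move=> t _; exact: integral_ge0.
- exact: (measurable_fun_fubini_tonelli_G (fun q => (g q)%:E)).
- apply/measurable_EFinP; apply: measurable_funM; first exact: measurable_beta_moment.
  exact: measurable_funM.
move=> t _; set b := (a + w t)%R.
have mab : measurable (`[a, b]%classic : set Rp) by exact: measurable_itv.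
rewrite (_ : (fun s => _) = fun s => (beta_moment L 0 t)%:E * (\1_`[a, b] s)%:E);
  last first.
  apply/funext => s; rewrite -EFinM /g/= mulrC indicE.
  by congr ((_ * (nat_of_bool _)%:R)%:E); rewrite mem_setE in_itv.
rewrite ge0_integralZl//; last 2 first.
- exact/measurable_EFinP/measurable_indic.
- by rewrite lee_fin beta_moment_ge0.
rewrite (EFinM (beta_moment L 0 t)); apply: lee_wpmul2l.
  by rewrite lee_fin beta_moment_ge0.
rewrite integral_indic// setIT.
have := @beta_prob_itv_le R n a b; rewrite {2}/b addrAC subrr add0r; apply.
by rewrite /b lerDl.
Qed.

Lemma boundary_integral_le (A : set CP) (p : CP) (a : R) (L : nat) : (1 <= L)%N ->
  measurable A ->
  (forall x, A x -> a <= overlap p x)%R -> (forall y, ~ A y -> overlap p y <= a)%R ->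
  measurable_fun setT (fun q : CP * CP => overlap q.1 q.2 ^+ L)%R ->
  \int[vol]_x \int[vol]_y (\1_A x * \1_(~` A) y * overlap x y ^+ L)%:E <=
  (d%:R * d.+1%:R / ('C(d + L, d)%:R * Num.sqrt L%:R))%:E.
Proof.
move=> L1 mA Aa aA mL.
apply: (le_trans (boundary_integral_shell mA Aa aA mL)).
(* The moment of order 0 is weighted by d/s and that of order 1 by d s; the latter moment is smaller
   by a factor of order 1/L = 1/s^2. *)
set s := Num.sqrt L%:R.
have s0 : (0 < s)%R by rewrite sqrtr_gt0 ltr0n.
have s2 : (s ^+ 2 = L%:R)%R by rewrite sqr_sqrtr.
apply: (@le_trans _ _ (\int[beta]_t ((d%:R / s * beta_moment L 0 t)%:E +
                                     (d%:R * s * beta_moment L 1 t)%:E))).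
  apply: ge0_le_integral => //.
  - by move=> t _; rewrite lee_fin !mulr_ge0 ?beta_moment_ge0 ?sqrtr_ge0.
  - apply/measurable_EFinP; apply: measurable_funM; first exact: measurable_beta_moment.
    apply: measurable_funM => //; apply: measurable_funM => //.
    apply: (measurableT_comp (continuous_measurable_fun (@sqrt_continuous R))).
    exact: measurable_funB.
  - apply/measurable_EFinP; apply: measurable_funD; apply: measurable_funM => //;
    exact: measurable_beta_moment.
  move=> t _; rewrite -EFinD lee_fin /beta_moment !patchE; case: ifPn => [|_]; last first.
    by rewrite mul0r !mulr0 addr0.
  move=> /set_mem; rewrite /= in_itv/= => /andP[t0 t1].
  rewrite XMonemXn0 /XMonemX expr1.
  by apply: shell_amgm; rewrite ?exprn_ge0.
rewrite ge0_integralD//; last 4 first.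
- by move=> t _; rewrite lee_fin !mulr_ge0 ?beta_moment_ge0// invr_ge0 ltW.
- by apply/measurable_EFinP; apply: measurable_funM => //; exact: measurable_beta_moment.
- by move=> t _; rewrite lee_fin !mulr_ge0 ?beta_moment_ge0// ltW.
- by apply/measurable_EFinP; apply: measurable_funM => //; exact: measurable_beta_moment.
have int k (c : R) : (0 <= c)%R -> \int[beta]_t (c * beta_moment L k t)%:E =
    (c * (beta_fun L.+1 (n + k).+1 / beta_fun 1 n.+1))%:E.
  move=> c0; rewrite EFinM -integral_beta_moment -ge0_integralZl//.
  - by apply/measurable_EFinP; exact: measurable_beta_moment.
  - by move=> t _; rewrite lee_fin beta_moment_ge0.
rewrite !int; last 2 first.
- by rewrite mulr_ge0// ltW.
- by rewrite divr_ge0// ltW.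
rewrite -EFinD lee_fin addn0 addn1 beta_fun_succ.
rewrite -[X in (d%:R * s * X)%R]mulrA !beta_fun_binomial.
have N0 : (0 < 'C(d + L, d)%:R :> R)%R by rewrite ltr0n bin_gt0 leq_addr.
move: N0; set N := 'C(_, _)%:R => N0.
(* Writing n + 2 = 1 + (n + 1) splits the target so that its first summand is exactly the term of
   order 0. The second dominates the term of order 1 because s^2 = L <= L + n + 2. *)
have -> : (d%:R * n.+2%:R / (N * s) = d%:R / s * N^-1 + d%:R / s * n.+1%:R * N^-1)%R.
  rewrite -[n.+2]addn1 natrD; move: (n.+1%:R : R) => c.
  by field; rewrite !gt_eqF.
rewrite lerD2l !mulrA; apply: ler_wpM2r; first by rewrite invr_ge0 ltW.
have M0 : (0 < (L + n).+2%:R :> R)%R by rewrite ltr0n.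
have sM : (s ^+ 2 <= (L + n).+2%:R)%R by rewrite s2 ler_nat -!addnS leq_addr.
rewrite ler_pdivrMr// -subr_ge0.
move: (d%:R : R) ((L + n).+2%:R : R) M0 sM => D M M0 sM.
have -> : (D / s * D * M - D * s * D = D ^+ 2 / s * (M - s ^+ 2))%R.
  by field; rewrite gt_eqF.
by rewrite mulr_ge0 ?subr_ge0// divr_ge0 ?sqr_ge0// ltW.
Qed.

End boundary_integral.

(** * The kernel of the projective ensemble *)

Section projective_kernel_facts.
Context (R : realType) (d L : nat).
Local Notation CP := (projective_space R d).
Implicit Types p q : CP.
Local Notation N := 'C(d + L, d).

Lemma affine_repE p : exists2 c : R[i], c != 0 & affine_rep p = c *: vpick p.
Proof.
rewrite /affine_rep; case: ifPn => [_|v0].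
  by exists 1; rewrite ?scale1r ?oner_neq0.
by exists ((vpick p 0 0)^-1); rewrite ?invr_neq0.
Qed.

Lemma hermitian_power_mul (C : numClosedFieldType) n (u v : 'rV[C]_n) (c e : C) :
  c = `|dotmx u v| ->
  (e * dotmx u v ^+ L) * (e * dotmx v u ^+ L) = e ^+ 2 * (c ^+ 2) ^+ L.
Proof. by move=> ->; rewrite mulrACA -expr2 -exprMn (dotmx_conj v u) normCK. Qed.

Lemma projective_kernel_diag p : projective_kernel L p p = N%:R.
Proof.
have [c c0 E] := affine_repE p.
rewrite /projective_kernel dotmx_unitv ?expr1n ?mulr1//.
by rewrite E scaler_eq0 (negPf c0) vpick_neq0.
Qed.

(** The two factors are complex conjugates, so phases cancel; the chosen representatives differ from
    [vpick] by nonzero scalars, to which coherence is insensitive. *)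
Lemma projective_kernel_sqr p q :
  projective_kernel L p q * projective_kernel L q p =
  (N%:R ^+ 2 * overlap p q ^+ L)%:C%C.
Proof.
have [a a0 Ea] := affine_repE p; have [b b0 Eb] := affine_repE q.
have E : coherence (affine_rep p) (affine_rep q) = coherence (vpick p) (vpick q).
  by rewrite Ea Eb coherenceZ.
transitivity (N%:R ^+ 2 * ((coherence (vpick p) (vpick q))%:C%C ^+ 2) ^+ L : R[i]).
  apply: hermitian_power_mul; rewrite -E; exact: coherenceE.
by rewrite rmorphM/= rmorphXn/= rmorph_nat !rmorphXn.
Qed.

End projective_kernel_facts.

Theorem theorem1p6 (R : realType) (d : nat) (hd : (1 <= d)%N) :
  exists2 K : R, 0 < K &
    forall L : nat, (1 <= L)%N ->
    forall (dO : measure_display) (Omega : measurableType dO)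
      (P : probability Omega R) (X : Omega -> {fset projective_space R d}),
    projective_ensemble P L X ->
    forall A : set (projective_space R d), metric_ball A ->
    let N := 'C(d + L, d) in
    let D := (2 * d)%N in
    ('V_P[fun w => (num_points X A w)%:R] <= (K * N%:R `^ (1 - D%:R^-1))%:E)%E.
Proof.
case: d hd => // n _.
(* The factor d (d+1) comes from the boundary integral, and the factor 2 from comparing N / sqrt L
   with the power of N. *)
exists (2 * (n.+1%:R * n.+2%:R)); first by rewrite !mulr_gt0// ltr0n.
move=> L L1 dO Omega P X [Xs Xd] A /metric_ball_overlap ballA; cbv zeta.
set N := 'C(_, _); set D := (2 * _)%N.
have [mA [p [a [Aa aA]]]] := ballA.
have N0 : 0 < N%:R :> R by rewrite ltr0n bin_gt0 leq_addr.
have o01 (x y : projective_space R n.+1) : 0 <= overlap x y ^+ L <= 1.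
  by have /andP[h0 h1] := @overlap_itv R n.+1 x y; rewrite exprn_ge0//= exprn_ile1.
pose k2 (x y : projective_space R n.+1) : R := N%:R ^+ 2 * overlap x y ^+ L.
have k2_itv x y : 0 <= k2 x y <= N%:R ^+ 2.
  have /andP[h0 h1] := o01 x y.
  by rewrite mulr_ge0 ?sqr_ge0//= ger_pMr// exprn_gt0.
have mk2 := measurable_k2 Xd (@projective_kernel_diag R n.+1 L)
  (@projective_kernel_sqr R n.+1 L).
(* Tonelli over pairs of points needs joint measurability; it is obtained from the second intensity
   of the process by dividing by N^2. *)
have mL : measurable_fun setT
    (fun q : projective_space R n.+1 * projective_space R n.+1 => overlap q.1 q.2 ^+ L).
  rewrite (_ : (fun q => _) = fun q => N%:R ^- 2 * k2 q.1 q.2); last first.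
    by apply/funext => q; rewrite mulKf// expf_neq0// gt_eqF.
  apply: measurable_funM => //.
  exact: (measurableT_comp mk2 (@measurable_pair_tuple _ _)).
rewrite (variance_num_points Xs Xd (@projective_kernel_diag R n.+1 L)
  (@projective_kernel_sqr R n.+1 L) k2_itv mA).
pose f (q : projective_space R n.+1 * projective_space R n.+1) : R :=
  \1_A q.1 * \1_(~` A) q.2 * overlap q.1 q.2 ^+ L.
have f0 q : 0 <= f q.
  by have /andP[h0 _] := o01 q.1 q.2; rewrite !mulr_ge0.
have mf : measurable_fun setT (fun q => (f q)%:E).
  apply/measurable_EFinP; apply: measurable_funM => //; apply: measurable_funM.
    exact: (measurableT_comp (measurable_indic mA)).
  exact: (measurableT_comp (measurable_indic (measurableC mA))).
pose vol := fs_volume R n.+1.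
have N20 : (0 <= (N%:R ^+ 2 : R)%:E)%E by rewrite lee_fin sqr_ge0.
have -> : (\int[vol]_x \int[vol]_y
      (\1_A x * \1_(~` A) y * (N%:R ^+ 2 * overlap x y ^+ L))%:E =
    (N%:R ^+ 2)%:E * \int[vol]_x \int[vol]_y (f (x, y))%:E)%E.
  rewrite -ge0_integralZl; first last.
  - exact: N20.
  - by move=> x _; apply: integral_ge0 => y _; rewrite lee_fin.
  - exact: (measurable_fun_fubini_tonelli_F (fun q => (f q)%:E)).
  - exact: measurableT.
  apply: eq_integral => x _; rewrite -ge0_integralZl; first last.
  - exact: N20.
  - by move=> y _; rewrite lee_fin.
  - have mx : measurable_fun setT (fun y : projective_space R n.+1 => (x, y)).
      exact/measurable_fun_pair.
    exact: (measurableT_comp mf mx).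
  - exact: measurableT.
  by apply: eq_integral => y _; rewrite -EFinM /f/=; congr EFin; rewrite mulrCA.
apply: (le_trans (lee_wpmul2l N20 (boundary_integral_le L1 mA Aa aA mL))).
rewrite -EFinM lee_fin.
have := @powR_binomial_ge R n.+1 L (ltn0Sn n) L1; rewrite -/N -/D.
have s0 : 0 < Num.sqrt L%:R :> R by rewrite sqrtr_gt0 ltr0n.
move: (N%:R `^ _) => y; move: (N%:R : R) (Num.sqrt L%:R : R) N0 s0 => M s M0 s0 Ms.
have -> : M ^+ 2 * (n.+1%:R * n.+2%:R / (M * s)) = n.+1%:R * n.+2%:R * (M / s).
  move: (n.+1%:R : R) (n.+2%:R : R) => b c.
  by field; rewrite !gt_eqF.
by rewrite [2 * _]mulrC -[leRHS]mulrA; apply: ler_wpM2l; first by rewrite mulr_ge0.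
Qed.
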